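(* Let $\pi^*$ be a regularized optimal policy and $c_m:=\min_s m_s$. Then for every $\theta\in\mathbb{R}^{|\mathcal S||\mathcal A|}$ and every initial state distribution $\rho$, $$\|\nabla_\theta\tilde V_\lambda^{\pi_\theta}(u)\|_2^2\ \ge\ 2\lambda c_u c_m\big(\min_{s,a}\pi_\theta(a|s)\big)^2\left\|\frac{d_\rho^{\pi^*}}{d_u^{\pi_\theta}}\right\|_\infty^{-1}\big(\tilde V_\lambda^{\pi^*}(\rho)-\tilde V_\lambda^{\pi_\theta}(\rho)\big).$$ Moreover, the coefficients $m_s$ for commonly used divergences are: for the $\alpha$-divergence $f(x)=\frac{x^{1-\alpha}-(1-\alpha)x-\alpha}{\alpha(\alpha-1)}$ with $\alpha\in(0,1)$, $m_s=(\min_a\pi_{\mathrm{ref}}(a|s))^\alpha$; for reverse KL $f(x)=x\log x$, $m_s=1$; for forward KL $f(x)=-\log x$, $m_s=\min_a\pi_{\mathrm{ref}}(a|s)$; for the JS-divergence $f(x)=x\log x-(x+1)\log\frac{x+1}{2}$, $m_s=\min_a\frac{\pi_{\mathrm{ref}}(a|s)}{1+\pi_{\mathrm{ref}}(a|s)}$; for the $\chi^2$-divergence $f(x)=(x-1)^2$, $m_s=\min_a\frac{2}{\pi_{\mathrm{ref}}(a|s)}$.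
   Context: $(\mathcal S,\mathcal A,\mathcal P,r,\gamma)$ is a discounted Markov decision process with finite state set $\mathcal S$, finite action set $\mathcal A$, transition probabilities $\mathcal P(s'|s,a)$, reward $r:\mathcal S\times\mathcal A\to[0,r_{\max}]$ and discount factor $\gamma\in[0,1)$. For $\theta\in\mathbb{R}^{|\mathcal S||\mathcal A|}$ the softmax policy is $\pi_\theta(a|s)=\exp(\theta_{sa})/\sum_{a'}\exp(\theta_{sa'})$; $\pi(s)$ denotes $\pi(\cdot|s)$. $\pi_{\mathrm{ref}}$ is a fixed reference policy with $\min_{s,a}\pi_{\mathrm{ref}}(a|s)>0$; $\lambda>0$. $u$ is a state distribution with $u(s)\ge c_u>0$ for all $s$. The generator $f:(0,\infty)\to\mathbb{R}$ is convex with $f(1)=0$ and twice differentiable, $f(0):=\lim_{x\downarrow0}f(x)\in(-\infty,+\infty]$, and $D_f(p,q):=\sum_x q(x)f(p(x)/q(x))$. For a policy $\pi$ and initial distribution $\rho$, $$\tilde V_\lambda^{\pi}(\rho)=\mathbb{E}\Big[\sum_{t\ge0}\gamma^t\big(r(s_t,a_t)-\lambda D_f(\pi(s_t),\pi_{\mathrm{ref}}(s_t))\big)\Big],$$ where $s_0\sim\rho$, $a_t\sim\pi(\cdot|s_t)$, $s_{t+1}\sim\mathcal P(\cdot|s_t,a_t)$. A regularized optimal policy $\pi^*$ is a policy (a map $\mathcal S\to\Delta_{|\mathcal A|}$) maximizing $\tilde V_\lambda^\pi(s)$ over policies simultaneously for every initial state $s$. The discounted state distribution is $d_\rho^\pi(s)=(1-\gamma)\sum_{t\ge0}\gamma^t\Pr(s_t=s\mid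 s_0\sim\rho,\pi)$, and $\|d/d'\|_\infty=\max_s d(s)/d'(s)$. Finally $$m_s:=\inf\Big\{f''\Big(\frac{p_a}{\pi_{\mathrm{ref}}(a|s)}\Big)\frac{1}{\pi_{\mathrm{ref}}(a|s)}:\ p\in\Delta_{|\mathcal A|},\ a\in\mathcal A,\ p_a>0\Big\},$$ where $\Delta_{|\mathcal A|}$ is the probability simplex over $\mathcal A$. *)

(* Defs.v *)
From HB Require Import structures.
From mathcomp Require Import all_boot all_order all_algebra.
From mathcomp Require Import all_classical all_reals all_analysis.
Set Implicit Arguments.
Unset Strict Implicit.
Unset Printing Implicit Defensive.
Import Order.TTheory GRing.Theory Num.Theory.
Import numFieldNormedType.Exports.
Local Open Scope classical_set_scope.
Local Open Scope ring_scope.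

(* Minimum and maximum of a real family indexed by a finite type; they are
   attained as soon as the index type is inhabited. *)
Definition minval (R : realType) (T : finType) (F : T -> R) : R := inf (range F).
Definition maxval (R : realType) (T : finType) (F : T -> R) : R := sup (range F).

Definition is_distr (R : realType) (T : finType) (p : T -> R) : Prop :=
  (forall x, 0 <= p x) /\ \sum_x p x = 1.

Definition point_mass (R : realType) (T : finType) (x : T) : T -> R :=
  fun y => (y == x)%:R.

(* [pi s a] is the probability pi(a|s). *)
Definition is_policy (R : realType) (S A : finType) (pi : S -> A -> R) : Prop :=
  forall s, is_distr (pi s).

(* [trans M s a s'] is the probability P(s'|s,a). *)
Record mdp (R : realType) (S A : finType) := Mdp {
  trans : S -> A -> S -> R;
  reward : S -> A -> R;
  rmax : R;
  gamma : R;
  trans_distr : forall s a, is_distr (trans s a);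
  reward_bounds : forall s a, 0 <= reward s a <= rmax;
  gamma_bounds : 0 <= gamma < 1
}.

(* The stochastic process s_0, a_0, s_1, a_1, ... of the decision process, on
   some sample space carrying, for each policy pi and initial distribution rho,
   a probability under which s_0 ~ rho, a_t ~ pi(.|s_t) and
   s_(t+1) ~ P(.|s_t, a_t).  These requirements are expressed by the
   probabilities of all finite histories, which determine the joint law. *)
Record mdp_process (R : realType) (S A : finType) (M : mdp R S A) :=
  MdpProcess {
  sample_display : measure_display;
  sample : measurableType sample_display;
  state : nat -> sample -> S;
  action : nat -> sample -> A;
  law : (S -> A -> R) -> (S -> R) -> probability sample R;
  measurable_state : forall t s, measurable [set w | state t w = s];
  measurable_action : forall t a, measurable [set w | action t w = a];
  law_history : forall (pi : S -> A -> R) (rho : S -> R),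
    is_policy pi -> is_distr rho ->
    forall (n : nat) (hs : nat -> S) (ha : nat -> A),
      law pi rho
        [set w | forall t, (t <= n)%N -> state t w = hs t /\ action t w = ha t]
      = (rho (hs 0%N) * pi (hs 0%N) (ha 0%N) *
         \prod_(t < n) (trans M (hs t) (ha t) (hs t.+1) *
                        pi (hs t.+1) (ha t.+1)))%:E
}.

Record is_generator (R : realType) (f : R -> R) : Prop := IsGenerator {
  generator_convex : convex_function (`]0, +oo[%classic : set R) f;
  generator_1 : f 1 = 0;
  generator_derivable : forall x : R, 0 < x -> derivable f x 1;
  generator_derivable2 : forall x : R, 0 < x -> derivable f^`()%classic x 1
}.

(* A generator f is only meaningful on ]0, +oo[, whatever total function
   represents it; its value at 0 is the limit f(0+), possibly +oo. *)
Definition generator0 (R : realType) (f : R -> R) (x : R) : \bar R :=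
  if x == 0 then lim ((f y)%:E @[y --> 0^'+]) else (f x)%:E.

Definition fdiv (R : realType) (T : finType) (f : R -> R) (p q : T -> R) :
    \bar R :=
  (\sum_x (q x)%:E * generator0 f (p x / q x))%E.

(* Regularized value; it is extended-real valued since the divergence may be
   +oo at policies that are not fully supported. *)
Definition value (R : realType) (S A : finType) (M : mdp R S A)
    (X : mdp_process M) (f : R -> R) (lambda : R) (pref : S -> A -> R)
    (pi : S -> A -> R) (rho : S -> R) : \bar R :=
  (\int[law X pi rho]_w
     \sum_(0 <= t <oo) (gamma M ^+ t)%:E *
       ((reward M (state t w) (action t w))%:E -
        lambda%:E * fdiv f (pi (state t w)) (pref (state t w))))%E.

Definition is_optimal (R : realType) (S A : finType) (M : mdp R S A)
    (X : mdp_process M) (f : R -> R) (lambda : R) (pref : S -> A -> R)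
    (pistar : S -> A -> R) : Prop :=
  is_policy pistar /\
  forall pi, is_policy pi -> forall s : S,
    (value X f lambda pref pi (point_mass R s) <=
     value X f lambda pref pistar (point_mass R s))%E.

Definition occupancy (R : realType) (S A : finType) (M : mdp R S A)
    (X : mdp_process M) (pi : S -> A -> R) (rho : S -> R) (s : S) : R :=
  (1 - gamma M) *
  limn (series (fun t => gamma M ^+ t *
                         fine (law X pi rho [set w | state t w = s]))).

(* The parameter space R^(|S||A|) is the space of |S| x |A| matrices, whose rows
   and columns are indexed by S and A through [enum_rank]. *)
Definition softmax (R : realType) (S A : finType) (theta : 'M[R]_(#|S|, #|A|))
    (s : S) (a : A) : R :=
  expR (theta (enum_rank s) (enum_rank a)) /
  \sum_(b : A) expR (theta (enum_rank s) (enum_rank b)).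

Definition gradient (R : realType) (m n : nat) (F : 'M[R]_(m, n) -> R)
    (theta : 'M[R]_(m, n)) : 'M[R]_(m, n) :=
  \matrix_(i, j) 'D_(delta_mx i j) F theta.

(* Euclidean norm; the library norm on matrices is the sup norm. *)
Definition norm2 (R : realType) (m n : nat) (g : 'M[R]_(m, n)) : R :=
  Num.sqrt (\sum_i \sum_j g i j ^+ 2).

(* The coefficient m_s. *)
Definition curvature (R : realType) (S A : finType) (f : R -> R)
    (pref : S -> A -> R) (s : S) : R :=
  inf [set x : R | exists (p : A -> R) (a : A),
    [/\ is_distr p, 0 < p a &
        x = f^`(2)%classic (p a / pref s a) * (1 / pref s a)]].

Definition alpha_gen (R : realType) (alpha x : R) : R :=
  (x `^ (1 - alpha) - (1 - alpha) * x - alpha) / (alpha * (alpha - 1)).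
Definition reverse_KL_gen (R : realType) (x : R) : R := x * ln x.
Definition forward_KL_gen (R : realType) (x : R) : R := - ln x.
Definition JS_gen (R : realType) (x : R) : R :=
  x * ln x - (x + 1) * ln ((x + 1) / 2).
Definition chi2_gen (R : realType) (x : R) : R := (x - 1) ^+ 2.

(* Main.v *)
Require Import Defs.
From HB Require Import structures.
From mathcomp Require Import all_boot all_order all_algebra.
From mathcomp Require Import all_classical all_reals all_analysis.
From mathcomp Require Import ring lra.
Set Implicit Arguments.
Unset Strict Implicit.
Unset Printing Implicit Defensive.
Import Order.TTheory GRing.Theory Num.Theory.
Import numFieldNormedType.Exports.
Local Open Scope classical_set_scope.
Local Open Scope ring_scope.

(** The inequality is a non-uniform Lojasiewicz inequality.  It combines a
    performance difference identity, a policy gradient formula and the strong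
    concavity, state by state, of the regularized one-step problem.

    Write [mu] for the discounted number of visits of the policy [pi] started
    from [u], and [v] for its regularized value function.  [mu] solves
    [mu = u + gamma P^T mu] ([visitationP]) and [v] solves the Bellman equation
    [v = g + gamma P v], [g] being the regularized reward.  Pairing the two
    equations gives the identity
      [V(pi', rho) - V(pi, rho) = sum_s mu'(s) (H_s(pi'(s)) - H_s(pi(s)))]
    with [H_s(p) = sum_a p_a Q(s,a) - lambda D_f(p, pref(s))], where [Q] is the
    one-step lookahead over [v] and [mu'] counts the visits of [pi'] from [rho]
    ([performance_difference], [reg_rewardE]); the values of both policies have
    to be finite, which optimality ensures for [pistar] ([optimal_fdiv_fin]).

    This identity is used twice.
    - With [pi'] a softmax policy whose parameter varies, every summand is the
      product of a factor [mu'(s)] that depends continuously on the parameter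
      ([visitation_lipschitz]) and a factor that is differentiable and vanishes
      at the base point.  Such a product is differentiable, and its
      differential ignores the derivative of [mu'] ([diff_mul_zero]).  This
      yields both differentiability and the gradient ([policy_gradient])
        [dV/dtheta(s,a) = mu(s) pi(a|s) adv(s,a)],
      [adv] being the gradient of [H_s] centred by its mean under [pi].
    - With [pi'] the optimal policy, [m_s] bounds the curvature of the
      divergence along the segment from [pi(s)] to [pistar(s)], so that
      [H_s(pistar(s)) - H_s(pi(s)) <= sum_a adv(s,a)^2 / (2 lambda c_m)]
      if [c_m > 0], the claim being trivial otherwise ([regularized_gap]).  A
      component of [pistar(s)] may vanish; there the tangent inequality is
      obtained by passing to the limit ([strong_tangent]).
    Since [mu(s) >= u(s) >= c_u], the two facts are compared in
    [lojasiewicz_algebra].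

    The analytic facts about the process are that the state distributions obey
    the forward recursion ([law_state_action]), that a finite value is the
    pairing of [mu] with [g], by dominated convergence ([value_finE]), and that
    an infinite divergence at the initial state makes the value -oo
    ([value_Ny]).  The coefficients of the classical divergences come from
    their second derivatives: each of them makes [f''(x/q)/q] nonincreasing in
    [x], so the infimum is reached at a point mass ([curvature_minval]). *)

(** * Extrema over a finite type and finite distributions *)

Lemma minvalP (R : realType) (T : finType) (F : T -> R) (x0 : T) :
  (forall x, minval F <= F x) /\ exists x, minval F = F x.
Proof.
pose m := [arg min_(x < x0) F x]%O.
have mP y : F m <= F y by rewrite /m; case: arg_minP => // i _; exact.
have -> : minval F = F m.
  apply/eqP; rewrite eq_le; apply/andP; split.
    by apply: ge_inf; [exists (F m) => _ [y _ <-]; exact: mP|exists m].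
  by apply: lb_le_inf; [exists (F m), m|move=> _ [y _ <-]; exact: mP].
by split => //; exists m.
Qed.

Lemma maxvalP (R : realType) (T : finType) (F : T -> R) (x0 : T) :
  (forall x, F x <= maxval F) /\ exists x, maxval F = F x.
Proof.
pose m := [arg max_(x > x0) F x]%O.
have mP y : F y <= F m by rewrite /m; case: arg_maxP => // i _; exact.
have -> : maxval F = F m.
  apply/eqP; rewrite eq_le; apply/andP; split.
    by apply: ge_sup; [exists (F m), m|move=> _ [y _ <-]; exact: mP].
  by apply: ub_le_sup; [exists (F m) => _ [y _ <-]; exact: mP|exists m].
by split => //; exists m.
Qed.

Lemma distr_inhabited (R : realType) (T : finType) (p : T -> R) :
  is_distr p -> exists x : T, True.
Proof.
move=> [_ p1]; case: (pickP T) => [x _|T0]; first by exists x.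
by move: p1; rewrite big_pred0// => /esym/eqP; rewrite oner_eq0.
Qed.

Lemma distr_le1 (R : realType) (T : finType) (p : T -> R) x :
  is_distr p -> p x <= 1.
Proof. by move=> [p0 <-]; rewrite (bigD1 x)//= lerDl sumr_ge0. Qed.

Lemma point_mass_distr (R : realType) (T : finType) (x : T) :
  is_distr (point_mass R x).
Proof.
split=> [y|]; first by rewrite /point_mass ler0n.
rewrite (bigD1 x)//= big1 ?addr0 /point_mass ?eqxx// => y /negPf.
by move=> ->.
Qed.

(** * Convex generators *)

Lemma derive_le (R : realType) (g : R -> R) (x v c : R) :
  derivable g x v ->
  (forall h, 0 < h -> h < 1 -> h^-1 * (g (h * v + x) - g x) <= c) ->
  'D_v g x <= c.
Proof.
move=> dg hc; apply: (cvgr_to_le (cvg_dnbhs_at_right dg)) => /=.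
near=> h; apply: hc; near: h; [exact: nbhs_right_gt|exact: nbhs_right_lt].
Unshelve. all: by end_near. Qed.

(** A directional derivative of a function of one real variable is a multiple of
    its derivative. *)
Lemma derive1_dir (R : realType) (f : R -> R) (x v : R) :
  derivable f x 1 -> derivable f x v /\ 'D_v f x = f^`()%classic x * v.
Proof.
move=> /derivable1_diffP df; split; first exact: diff_derivable.
rewrite deriveE// derive1E deriveE//.
by rewrite -[in LHS](mulr1 v) -[v * 1]/(v *: 1) linearZ/= mulrC.
Qed.

Section generator.
Variables (R : realType) (f : R -> R).
Hypothesis gf : is_generator f.

Lemma generator_is_derive (x : R) : 0 < x -> is_derive x 1 f (f^`()%classic x).
Proof.
move=> x0; apply: DeriveDef; first exact: generator_derivable.
by rewrite derive1E.
Qed.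

Lemma generator_is_derive2 (x : R) : 0 < x ->
  is_derive x 1 f^`()%classic (f^`(2)%classic x).
Proof.
move=> x0; apply: DeriveDef; first exact: generator_derivable2.
by rewrite -derive1E.
Qed.

Lemma generator_tangent x y : 0 < x -> 0 < y ->
  f x + f^`()%classic x * (y - x) <= f y.
Proof.
move=> x0 y0; rewrite -lerBrDl.
have [df <-] := derive1_dir (y - x) (generator_derivable gf x0).
apply: derive_le => // h h0 h1.
pose t := Itv01 (ltW h0) (ltW h1).
have := @generator_convex _ _ gf t y x; rewrite !inE/= !in_itv/= !andbT => /(_ y0 x0).
rewrite !convRE/=.
rewrite [X in f X](_ : _ = h * (y - x) + x); last first.
  rewrite -[conv _ _ _]/(t%:num * y + (1 - t%:num) * x) /=; ring.
by move=> H; rewrite mulrC ler_pdivrMr//; move: H; rewrite /unstable.onem; lra.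
Qed.

Lemma generator_derive_homo x y : 0 < x -> x <= y ->
  f^`()%classic x <= f^`()%classic y.
Proof.
move=> x0; rewrite le_eqVlt => /predU1P[->//|xy].
have y0 := lt_trans x0 xy.
have := generator_tangent x0 y0; have := generator_tangent y0 x0.
by move=> H1 H2; rewrite -(ler_pM2r (_ : 0 < y - x)) ?subr_gt0//; lra.
Qed.

Lemma generator_derive2_ge0 x : 0 < x -> 0 <= f^`(2)%classic x.
Proof.
move=> x0; rewrite derive1nS derive1n1 -oppr_le0 derive1E -deriveN; last first.
  exact: generator_derivable2.
apply: derive_le => [|h h0 h1].
  by apply: derivableN; exact: generator_derivable2.
rewrite pmulr_rle0 ?invr_gt0// -opprD oppr_le0 subr_ge0.
by apply: generator_derive_homo => //; rewrite mulr1 lerDr ltW.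
Qed.

(** The limit of [f] at 0+ exists in the extended reals and is not -oo: up to an
    affine function, [f] is nonnegative and nonincreasing on ]0, 1[. *)
Lemma generator0_cvg :
  (f y)%:E @[y --> 0^'+] --> generator0 f 0 /\ generator0 f 0 != -oo%E.
Proof.
have y0gt (y : R) : 0 < y -> 0 <= f y - f^`()%classic 1 * (y - 1).
  by move=> y0; have := generator_tangent (ltr01) y0; rewrite (generator_1 gf); lra.
(* Subtracting the tangent at 1 leaves a nonnegative nonincreasing function. *)
pose h y := (f y - f^`()%classic 1 * (y - 1))%:E.
have hcvg : exists2 l, h y @[y --> 0^'+] --> l & (0 <= l)%E.
  eexists; first apply: (@nonincreasing_at_right_cvge _ h 0 (BLeft 1)).
  - by rewrite bnd_simp.
  - move=> x y; rewrite !in_itv/= => /andP[x0 x1] /andP[y0 y1] xy.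
    rewrite lee_fin.
    have H1 := generator_tangent y0 x0.
    have H2 := generator_derive_homo y0 (ltW y1).
    have : 0 <= (f^`()%classic 1 - f^`()%classic y) * (y - x).
      by rewrite mulr_ge0 ?subr_ge0.
    by lra.
  - apply: (@le_trans _ _ (h 2^-1)); first by rewrite lee_fin y0gt.
    apply: ereal_sup_ubound; exists 2^-1 => //=.
    by rewrite in_itv/= invr_gt0 ltr0n invf_lt1 ?ltr1n.
have [l hl l0] := hcvg.
have cf : (f y)%:E @[y --> 0^'+] --> (l - (f^`()%classic 1)%:E)%E.
  have -> : (fun y => (f y)%:E) = (fun y => h y + (f^`()%classic 1 * (y - 1))%:E)%E.
    by apply/funext => y; rewrite /h -EFinD subrK.
  apply: cvgeD => //; first by rewrite fin_num_adde_defl.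
  apply: cvg_EFin; first by near=> y.
  rewrite [X in _ --> X](_ : _ = f^`()%classic 1 * (0 - 1)); last by rewrite /= sub0r mulrN1.
  apply: cvg_at_right_filter.
  by apply: cvgM; [exact: cvg_cst|apply: cvgB; [exact: cvg_id|exact: cvg_cst]].
have E : generator0 f 0 = (l - (f^`()%classic 1)%:E)%E.
  by rewrite /generator0 eqxx; apply/cvg_lim.
by rewrite E; split => //; case: l l0 {hl cf E}.
Unshelve. all: by end_near. Qed.

Lemma generator0_gtNy x : 0 <= x -> generator0 f x != -oo%E.
Proof.
rewrite le_eqVlt => /predU1P[<-|x0]; first exact: (generator0_cvg).2.
by rewrite /generator0 (negbTE (lt0r_neq0 x0)).
Qed.

(** The tangent inequality at [y], improved by a lower bound [c] of the second
    derivative on the segment between [x] and [y]. *)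
Lemma strong_tangent_gt0 (c x y : R) : 0 < x -> 0 < y ->
  (forall t, 0 <= t <= 1 -> c <= f^`(2)%classic (x + t * (y - x))) ->
  f y + f^`()%classic y * (x - y) + c / 2 * (x - y) ^+ 2 <= f x.
Proof.
move=> x0 y0 hc.
have pos t : 0 <= t <= 1 -> 0 < x + t * (y - x).
  move=> /andP[t0 t1]; have [xy|yx] := leP x y.
    by rewrite ltr_pwDl// mulr_ge0// subr_ge0.
  rewrite (_ : _ + _ = (1 - t) * (x - y) + y); last by ring.
  by rewrite ltr_wpDl// mulr_ge0// subr_ge0// ltW.
(* The function [k] below goes from f x at t = 0 to the left-hand side at
   t = 1; it is nonincreasing. *)
pose L t := x + t * (y - x).
have dL t : is_derive (t : R) 1 L (y - x).
  rewrite (_ : L = cst x + (y - x) \*: (@id R)); last first.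
    by apply/funext => u; rewrite /L /= mulrC.
  have := is_deriveD (is_derive_cst x t 1) (is_deriveZ (y - x) (is_derive_id t 1)).
  by rewrite add0r -[_ *: _]/((y - x) * 1) mulr1.
pose k t := f (L t) + f^`()%classic (L t) * (x - L t) + c / 2 * (x - L t) ^+ 2.
have dk (t : R) : 0 <= t <= 1 ->
    is_derive t 1 k ((f^`(2)%classic (L t) - c) * (x - L t) * (y - x)).
  move=> t01.
  have d1 : is_derive (L t) 1 f (f^`()%classic (L t)).
    exact/generator_is_derive/pos.
  have d2 : is_derive (L t) 1 f^`()%classic (f^`(2)%classic (L t)).
    exact/generator_is_derive2/pos.
  have c1 := is_derive1_comp d1 (dL t).
  have c2 := is_derive1_comp d2 (dL t).
  rewrite (_ : k = (f \o L) + (f^`()%classic \o L) * (cst x - L)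
                  + c / 2 *: ((cst x - L) ^+ 2)); last first.
    by apply/funext => u; rewrite /k /=.
  have dM := is_deriveB (is_derive_cst x t 1) (dL t).
  have dX := is_deriveX 2 dM.
  have := is_deriveD (is_deriveD c1 (is_deriveM c2 dM)) (is_deriveZ (c / 2) dX).
  move/is_derive_eq; apply.
  rewrite /= !fctE /GRing.scale/= sub0r; by field.
have : k 1 <= k 0.
  have := @ler0_derive1_nincr _ k 0 1; apply => //.
  - move=> t; rewrite in_itv/= => /andP[t0 t1].
    have H : 0 <= t <= 1 by rewrite !ltW.
    by have [] := dk t H.
  - move=> t; rewrite in_itv/= => /andP[t0 t1].
    have H : 0 <= t <= 1 by rewrite !ltW.
    rewrite derive1E (@derive_val _ _ _ _ _ _ _ (dk t H)).
    rewrite (_ : _ * _ = - ((f^`(2)%classic (L t) - c) * t * (y - x)^+2)); last first.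
      by rewrite /L; ring.
    by rewrite oppr_le0 mulr_ge0 ?sqr_ge0// mulr_ge0 ?(ltW t0)// subr_ge0 hc.
  - apply: derivable_within_continuous => t; rewrite in_itv/= => H.
    by have [] := dk t H.
rewrite /k /L mul1r mul0r !addr0 subrr expr0n/= !mulr0 !addr0.
by rewrite (_ : x + (y - x) = y); [|ring].
Qed.

(** The same inequality for [x >= 0]; at [x = 0] it is the limit of the
    inequalities at [z > 0]. *)
Lemma strong_tangent (c x y : R) : 0 <= x -> 0 < y ->
  (forall z, 0 < z -> Num.min x y <= z <= Num.max x y -> c <= f^`(2)%classic z) ->
  generator0 f x \is a fin_num ->
  f y + f^`()%classic y * (x - y) + c / 2 * (x - y) ^+ 2
  <= fine (generator0 f x).
Proof.
move=> x0 y0 hc.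
have mono x' : 0 < x' -> x <= x' -> x' <= Num.max x y ->
    f y + f^`()%classic y * (x' - y) + c / 2 * (x' - y) ^+ 2 <= f x'.
  move=> x'0 xx' x'm; apply: strong_tangent_gt0 => // t /andP[t0 t1].
  set z := x' + _.
  have zE : z = (1 - t) * x' + t * y by rewrite /z; ring.
  have le1 : Num.min x' y <= z.
    rewrite zE (_ : Num.min x' y = (1 - t) * Num.min x' y + t * Num.min x' y); last by ring.
    by rewrite lerD// ler_wpM2l ?subr_ge0// ge_min lexx ?orbT.
  have le2 : z <= Num.max x' y.
    rewrite zE (_ : Num.max x' y = (1 - t) * Num.max x' y + t * Num.max x' y); last by ring.
    by rewrite lerD// ler_wpM2l ?subr_ge0// le_max lexx ?orbT.
  apply: hc; first by apply: lt_le_trans le1; rewrite lt_min x'0 y0.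
  apply/andP; split.
    apply: le_trans le1; rewrite le_min !ge_min xx' lexx ?orbT//.
  apply: (le_trans le2); rewrite ge_max x'm le_max lexx ?orbT//.
move: x0; rewrite le_eqVlt => /predU1P[x0|x0]; last first.
  by move=> _; rewrite /generator0 gt_eqF//=; apply: mono => //; rewrite le_max lexx.
rewrite -x0 => fin.
have [cv _] := generator0_cvg.
have cvf : f z @[z --> 0^'+] --> fine (generator0 f 0).
  by move: cv; rewrite -{1}(fineK fin) => /fine_cvg.
pose Q z := f y + f^`()%classic y * (z - y) + c / 2 * (z - y) ^+ 2.
have cvQ : Q z @[z --> 0^'+] --> Q 0.
  apply: cvg_at_right_filter; rewrite /Q.
  apply: cvgD; first apply: cvgD; [exact: cvg_cst| |].
    by apply: cvgM; [exact: cvg_cst|apply: cvgB; [exact: cvg_id|exact: cvg_cst]].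
  apply: cvgM; first exact: cvg_cst.
  rewrite expr2; under eq_fun do rewrite expr2.
  by apply: cvgM; apply: cvgB; (exact: cvg_id || exact: cvg_cst).
apply: (ler_cvg_to cvQ cvf).
near=> z; apply: mono.
- by near: z; exact: nbhs_right_gt.
- by rewrite -x0 ltW//; near: z; exact: nbhs_right_gt.
- rewrite le_max; apply/orP; right; near: z; exact: nbhs_right_le.
Unshelve. all: by end_near. Qed.

End generator.

(** * Divergences and curvature coefficients *)

(** The f-divergence as a real number.  It is meaningful when every value
    [generator0 f (p x / q x)] is finite, [fine] sending infinite values to 0. *)
Definition fdivr (R : realType) (T : finType) (f : R -> R) (p q : T -> R) : R :=
  \sum_x q x * fine (generator0 f (p x / q x)).

Section fdiv.
Variables (R : realType) (T : finType) (f : R -> R) (p q : T -> R).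
Hypothesis gf : is_generator f.
Hypothesis q0 : forall x, 0 < q x.

Lemma generator0_gt0 (x : R) : 0 < x -> generator0 f x = (f x)%:E.
Proof. by move=> x0; rewrite /generator0 (negbTE (lt0r_neq0 x0)). Qed.

Lemma fdivE : (forall x, generator0 f (p x / q x) \is a fin_num) ->
  fdiv f p q = (fdivr f p q)%:E.
Proof.
move=> fin; rewrite /fdiv /fdivr -sumEFin; apply: eq_bigr => x _.
by rewrite EFinM fineK.
Qed.

Lemma fdivr_gt0 : (forall x, 0 < p x) ->
  fdivr f p q = \sum_x q x * f (p x / q x).
Proof.
move=> p0; apply: eq_bigr => x _.
by rewrite generator0_gt0// divr_gt0.
Qed.

Lemma fdiv_cases : (forall x, 0 <= p x) ->
  (forall x, generator0 f (p x / q x) \is a fin_num) \/ fdiv f p q = +oo%E.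
Proof.
move=> p0; have g0 x : generator0 f (p x / q x) != -oo%E.
  by apply: generator0_gtNy => //; rewrite divr_ge0// ltW.
have [fin|/existsNP[x xoo]] :=
    pselect (forall x, generator0 f (p x / q x) \is a fin_num).
  by left.
right; apply/esum_eqyP => [y _|].
  by move: (g0 y); case: generator0 => //= _; rewrite gt0_muley// lte_fin.
exists x; rewrite mem_index_enum; split=> //.
by move: xoo (g0 x); case: generator0 => //= _ _; rewrite gt0_muley// lte_fin.
Qed.

End fdiv.

Section curvature.
Variables (R : realType) (S A : finType) (f : R -> R) (pref : S -> A -> R).
Hypothesis pref0 : forall s a, 0 < pref s a.
Hypothesis f2 : forall x : R, 0 < x -> 0 <= f^`(2)%classic x.

Lemma curvature_le s (p : A -> R) a : is_distr p -> 0 < p a ->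
  curvature f pref s <= f^`(2)%classic (p a / pref s a) * (1 / pref s a).
Proof.
move=> pd pa; apply: ge_inf; last by exists p, a.
exists 0 => _ [p' [a' [_ pa' ->]]].
by rewrite mulr_ge0 ?f2 ?divr_gt0// divr_ge0// ltW.
Qed.

Lemma curvature_ge0 s : 0 <= curvature f pref s.
Proof.
rewrite /curvature; have [->|/set0P H] := eqVneq
    [set x : R | exists (p : A -> R) (a : A), [/\ is_distr p, 0 < p a &
       x = f^`(2)%classic (p a / pref s a) * (1 / pref s a)]] set0.
  by rewrite inf0.
apply: lb_le_inf => // _ [p' [a' [_ pa' ->]]].
by rewrite mulr_ge0 ?f2 ?divr_gt0// divr_ge0// ltW.
Qed.

End curvature.

(** If [x -> k (x / q) / q], with [k] the second derivative of [f], is minimal at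
    [x = 1] on ]0, 1], the coefficient is reached at a point mass and is the
    minimum over the actions of [k (1 / q) / q]. *)
Lemma curvature_minval (R : realType) (S A : finType) (f k : R -> R)
    (pref : S -> A -> R) (G : A -> R) (s : S) :
  is_distr (pref s) -> (forall a, 0 < pref s a) ->
  (forall z : R, 0 < z -> f^`(2)%classic z = k z) ->
  (forall a, k (1 / pref s a) * (1 / pref s a) = G a) ->
  (forall a x, 0 < x <= 1 -> G a <= k (x / pref s a) * (1 / pref s a)) ->
  curvature f pref s = minval G.
Proof.
move=> prefd pref0 f2k Gk kG.
have [a0 _] := distr_inhabited prefd.
have [minle [a minE]] := minvalP G a0.
have lb p b : is_distr p -> 0 < p b ->
    minval G <= f^`(2)%classic (p b / pref s b) * (1 / pref s b).
  move=> pd pb; apply: (le_trans (minle b)).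
  by rewrite f2k ?divr_gt0//; apply: kG; rewrite pb distr_le1.
apply/eqP; rewrite eq_le; apply/andP; split.
  rewrite minE -Gk -f2k ?divr_gt0//; apply: ge_inf.
    by exists (minval G) => _ [p [b [pd pb ->]]]; exact: lb.
  exists (point_mass R a), a; rewrite /point_mass eqxx; split => //.
  exact: point_mass_distr.
apply: lb_le_inf; last by move=> _ [p [b [pd pb ->]]]; exact: lb.
exists (f^`(2)%classic (1 / pref s a) * (1 / pref s a)), (point_mass R a), a.
by rewrite /point_mass eqxx; split => //; exact: point_mass_distr.
Qed.

Lemma derive2E (R : realType) (f g k : R -> R) :
  (forall z : R, 0 < z -> is_derive z 1 f (g z)) ->
  (forall z : R, 0 < z -> is_derive z 1 g (k z)) ->
  forall z : R, 0 < z -> f^`(2)%classic z = k z.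
Proof.
move=> df dg z z0; rewrite -(@derive_val _ _ _ _ _ _ _ (dg z z0)).
rewrite derive1nS derive1n1 derive1E; apply: near_eq_derive.
near=> y; rewrite derive1E; apply: derive_val; apply: df.
by near: y; exact: lt_nbhsr.
Unshelve. all: by end_near. Qed.

Section examples.
Variables (R : realType).
Implicit Type z : R.

Lemma alpha_gen_derive2 (alpha z : R) : 0 < alpha < 1 -> 0 < z ->
  (alpha_gen alpha)^`(2)%classic z = z `^ (- alpha - 1).
Proof.
move=> /andP[a0 a1].
have a0' : alpha != 0 by rewrite gt_eqF.
have a1' : alpha - 1 != 0 by rewrite subr_eq0 lt_eqF.
pose c := (alpha * (alpha - 1))^-1.
pose g (x : R) := c * ((1 - alpha) * x `^ (- alpha) - (1 - alpha)).
have dpow (r y : R) : 0 < y ->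
    is_derive y 1 (fun x : R => x `^ r) (r * y `^ (r - 1)).
  exact: is_derive1_powR.
have d1 (y : R) : 0 < y -> is_derive y 1 (alpha_gen alpha) (g y).
  move=> y0.
  have dX := is_deriveZ (1 - alpha) (is_derive_id y 1).
  have dB := is_deriveB (is_deriveB (dpow (1 - alpha) y y0) dX) (is_derive_cst alpha y 1).
  have dZ := is_deriveZ c dB.
  rewrite (_ : alpha_gen alpha =
     c \*: ((fun x : R => x `^ (1 - alpha)) - (1 - alpha) \*: (@id R) - cst alpha)); last first.
    by apply/funext => x; rewrite /alpha_gen !fctE mulrC.
  apply: (is_derive_eq dZ); rewrite /GRing.scale/= subr0 mulr1 /g.
  by rewrite (_ : 1 - alpha - 1 = - alpha)//; ring.
have d2 (y : R) : 0 < y -> is_derive y 1 g (y `^ (- alpha - 1)).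
  move=> y0.
  have dZ := is_deriveZ c (is_deriveB (is_deriveZ (1 - alpha) (dpow (- alpha) y y0))
                                      (is_derive_cst (1 - alpha) y 1)).
  apply: (is_derive_eq dZ).
  by rewrite /GRing.scale/= subr0 /c; field; rewrite a0' a1'.
exact: (derive2E d1 d2).
Qed.

Lemma ln_scale_derive (y : R) : 0 < y -> is_derive y 1 ((@id R) * (@ln R)) (ln y + 1).
Proof.
move=> y0; apply: is_derive_eq; first by apply: is_deriveM; exact: is_derive1_ln.
by rewrite /GRing.scale/= mulfV ?gt_eqF// mulr1 addrC.
Qed.

Lemma inv_derive (y : R) : 0 < y -> is_derive y 1 (fun x : R => x^-1) (- y ^- 2).
Proof.
move=> y0; apply: is_derive_eq; first by apply: is_deriveV; rewrite ?gt_eqF.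
by rewrite /GRing.scale/= mulr1.
Qed.

Lemma reverse_KL_gen_derive2 z : 0 < z ->
  (@reverse_KL_gen R)^`(2)%classic z = z^-1.
Proof.
apply: (@derive2E _ _ (fun x => ln x + 1) GRing.inv) => y y0.
  exact: ln_scale_derive.
apply: is_derive_eq; first by apply: is_deriveD; exact: is_derive1_ln.
by rewrite addr0.
Qed.

Lemma forward_KL_gen_derive2 z : 0 < z ->
  (@forward_KL_gen R)^`(2)%classic z = z ^- 2.
Proof.
apply: (@derive2E _ _ (fun x => - x^-1) (fun x => x ^- 2)) => y y0.
  by apply: is_deriveN; exact: is_derive1_ln.
apply: is_derive_eq; first by apply: is_deriveN; exact: inv_derive.
by rewrite opprK.
Qed.

Lemma JS_gen_derive2 z : 0 < z ->
  (@JS_gen R)^`(2)%classic z = z^-1 - (z + 1)^-1.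
Proof.
have half0 (y : R) : 0 < y -> 0 < (y + 1) / 2.
  by move=> y0; rewrite divr_gt0// addr_gt0.
have dL (y : R) : is_derive y 1 (fun x : R => (x + 1) / 2) 2^-1.
  rewrite (_ : (fun _ => _) = 2^-1 \*: ((@id R) + cst 1)); last first.
    by apply/funext => x; rewrite mulrC.
  by apply: is_derive_eq; rewrite /GRing.scale/= addr0 mulr1.
have dln (y : R) : 0 < y ->
    is_derive y 1 (fun x : R => ln ((x + 1) / 2)) (y + 1)^-1.
  move=> y0; have d1 := is_derive1_ln (half0 y y0).
  have d := @is_derive1_comp R (@ln R) (fun x : R => (x + 1) / 2) y _ _ d1 (dL y).
  apply: (is_derive_eq d); field.
  by rewrite gt_eqF// addr_gt0.
apply: (@derive2E _ _ (fun x => ln x - ln ((x + 1) / 2))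
  (fun x => x^-1 - (x + 1)^-1)) => y y0; last first.
  apply: is_deriveB; [exact: is_derive1_ln|exact: dln].
rewrite (_ : @JS_gen R = (@id R) * (@ln R)
   - ((@id R) + cst 1) * (fun x : R => ln ((x + 1) / 2))); last first.
  by apply/funext => x.
apply: is_derive_eq.
  apply: is_deriveB; first exact: ln_scale_derive.
  by apply: is_deriveM; exact: dln.
rewrite /GRing.scale/= !fctE addr0; field.
by rewrite gt_eqF// addr_gt0.
Qed.

Lemma chi2_gen_derive2 z : 0 < z -> (@chi2_gen R)^`(2)%classic z = 2.
Proof.
apply: (@derive2E _ _ (2 \*: ((@id R) - cst 1)) (cst 2)) => y y0.
  rewrite (_ : @chi2_gen R = ((@id R) - cst 1) ^+ 2); last first.
    by apply/funext => x.
  apply: is_derive_eq; rewrite /GRing.scale/= subr0 expr1 mulr1.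
  by rewrite /= !fctE.
by apply: is_derive_eq; rewrite /GRing.scale/= subr0 mulr1.
Qed.

End examples.

Lemma curvature_examples (R : realType) (S A : finType) (pref : S -> A -> R)
    (s : S) : is_distr (pref s) -> (forall a, 0 < pref s a) ->
  [/\ forall alpha : R, 0 < alpha < 1 ->
        curvature (alpha_gen alpha) pref s = minval (pref s) `^ alpha,
      curvature (@reverse_KL_gen R) pref s = 1,
      curvature (@forward_KL_gen R) pref s = minval (pref s),
      curvature (@JS_gen R) pref s =
        minval (fun a => pref s a / (1 + pref s a)) &
      curvature (@chi2_gen R) pref s = minval (fun a => 2 / pref s a)].
Proof.
move=> prefd pref0; have [a0 _] := distr_inhabited prefd.
have pref_neq0 a : pref s a != 0 by rewrite gt_eqF.
split.
- move=> alpha alpha01; have /andP[alpha0 alpha1] := alpha01.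
  transitivity (minval (fun a => pref s a `^ alpha)).
    have alphaE (q x : R) : 0 < q -> 0 < x ->
        (x / q) `^ (- alpha - 1) * (1 / q) = q `^ alpha * x `^ (- alpha - 1).
      move=> q0 x0; rewrite powRM ?invr_ge0 ?ltW// -mulrA mulrC; congr (_ * _).
      rewrite -powR_inv1 ?ltW// -powRrM mulN1r opprB opprK addrC.
      by rewrite mul1r -powRD ?addrK// (gt_eqF q0) implybT.
    apply: (@curvature_minval _ _ _ _ (fun x => x `^ (- alpha - 1))) => //.
    + by move=> z z0; exact: alpha_gen_derive2.
    + by move=> a; rewrite alphaE// powR1 mulr1.
    + move=> a x /andP[x0 x1]; rewrite alphaE//.
      rewrite ler_pMr ?powR_gt0// -opprD powRN invf_ge1 ?powR_gt0//.
      rewrite [leRHS](_ : _ = 1 `^ (alpha + 1)); last by rewrite powR1.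
      by rewrite ge0_ler_powR ?nnegrE ?(ltW x0)// addr_ge0 ?ler01// ltW.
  have [mle [a ma]] := minvalP (pref s) a0.
  have [mle' [b mb]] := minvalP (fun a => pref s a `^ alpha) a0.
  apply/eqP; rewrite eq_le ma mle' mb andTb.
  by apply: ge0_ler_powR; rewrite ?nnegrE ?(ltW alpha0) ?(ltW (pref0 _))// -ma.
- transitivity (minval (fun _ : A => 1 : R)); last first.
    by have [_ [a ->]] := minvalP (fun _ : A => 1 : R) a0.
  apply: (@curvature_minval _ _ _ _ GRing.inv) => //.
  + exact: reverse_KL_gen_derive2.
  + by move=> a; field.
  + move=> a x /andP[x0 x1]; rewrite (_ : _ * _ = x^-1); last by field; rewrite pref_neq0 gt_eqF.
    by rewrite invf_ge1.
- apply: (@curvature_minval _ _ _ _ (fun x => x ^- 2)) => //.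
  + exact: forward_KL_gen_derive2.
  + by move=> a; field.
  + move=> a x /andP[x0 x1]; rewrite (_ : _ * _ = pref s a * x ^- 2); last by field; rewrite pref_neq0 gt_eqF.
    by rewrite ler_pMr// invf_ge1 ?exprn_gt0// exprn_ile1// ltW.
- have JSE (q x : R) : 0 < q -> 0 < x ->
      ((x / q)^-1 - (x / q + 1)^-1) * (1 / q) = q / (x * (x + q)).
    by move=> q0 x0; field; rewrite !gt_eqF ?addr_gt0.
  apply: (@curvature_minval _ _ _ _ (fun x => x^-1 - (x + 1)^-1)) => //.
  + exact: JS_gen_derive2.
  + by move=> a; rewrite JSE// mul1r.
  + move=> a x /andP[x0 x1]; rewrite JSE//.
    rewrite ler_pM2l// lef_pV2 ?posrE ?mulr_gt0 ?addr_gt0//.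
    have q0 := pref0 a; rewrite -[leRHS]mul1r.
    by rewrite ler_pM ?lerD2r// ?(ltW x0)// addr_ge0 ?(ltW x0) ?(ltW q0).
- apply: (@curvature_minval _ _ _ _ (fun=> 2)) => //.
  + exact: chi2_gen_derive2.
  + by move=> a; rewrite mul1r.
  + by move=> a x _; rewrite mul1r.
Qed.

Lemma sum_enum_val (R : nmodType) (T : finType) (F : T -> R) :
  \sum_x F x = \sum_(i < #|T|) F (enum_val i).
Proof. by apply: reindex; apply: onW_bij; exact: enum_val_bij. Qed.

(** * Discounted visitation and Bellman equations *)

Section dynamics.
Variables (R : realType) (S A : finType) (M : mdp R S A).
Implicit Types (pi : S -> A -> R) (mu rho g v : S -> R).

(** [kernel pi s s'] is the probability that [pi] moves from [s] to [s']. *)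
Definition kernel pi s s' : R := \sum_a pi s a * trans M s a s'.

(** [mu] satisfies the flow equation of the discounted number of visits of [pi]
    started from [rho]. *)
Definition is_visitation pi rho mu : Prop :=
  forall s', mu s' = rho s' + gamma M * \sum_s mu s * kernel pi s s'.

(** [v] is a value function of [pi] for the one-step reward [g]. *)
Definition is_bellman pi g v : Prop :=
  forall s, v s = g s + gamma M * \sum_s' kernel pi s s' * v s'.

Lemma gamma_ge0 : 0 <= gamma M.
Proof. by have /andP[] := gamma_bounds M. Qed.

Lemma gamma_lt1 : gamma M < 1.
Proof. by have /andP[] := gamma_bounds M. Qed.

Lemma sum_kernel_distr pi s : is_policy pi -> \sum_s' kernel pi s s' = 1.
Proof.
move=> pip; rewrite exchange_big/= -(pip s).2; apply: eq_bigr => a _.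
by rewrite -mulr_sumr (trans_distr M s a).2 mulr1.
Qed.

Lemma kernel_ge0 pi s s' : is_policy pi -> 0 <= kernel pi s s'.
Proof.
move=> pip; apply: sumr_ge0 => a _.
by rewrite mulr_ge0 ?(pip s).1// (trans_distr M s a).1.
Qed.

Lemma sum_visitation pi rho mu : is_policy pi -> is_distr rho ->
  is_visitation pi rho mu -> \sum_s mu s = (1 - gamma M)^-1.
Proof.
move=> pip rhod mup.
have E : \sum_s mu s = 1 + gamma M * \sum_s mu s.
  rewrite {1}(eq_bigr _ (fun s _ => mup s)) big_split/= rhod.2 -mulr_sumr.
  rewrite exchange_big/=; congr (_ + _ * _); apply: eq_bigr => s _.
  by rewrite -mulr_sumr sum_kernel_distr// mulr1.
have g1 : 1 - gamma M != 0 by rewrite subr_eq0 gt_eqF// gamma_lt1.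
by apply: (mulfI g1); rewrite mulfV// mulrBl mul1r {1}E addrK.
Qed.

(** The flow equations from all point masses say that a matrix [X] satisfies
    [X (1 - gamma P) = 1]; a one-sided inverse of a square matrix is two-sided,
    so [v = X g] solves the Bellman equation. *)
Lemma bellman_exists pi g (mu : S -> S -> R) :
  (forall s, is_visitation pi (point_mass R s) (mu s)) ->
  exists v, is_bellman pi g v.
Proof.
move=> mup.
pose N := #|S|.
pose P : 'M[R]_N := \matrix_(i, j) kernel pi (enum_val i) (enum_val j).
pose X : 'M[R]_N := \matrix_(i, j) mu (enum_val i) (enum_val j).
pose w : 'cV[R]_N := \col_i g (enum_val i).
have XP : X *m (1%:M - gamma M *: P) = 1%:M.
  rewrite mulmxBr mulmx1 -scalemxAr; apply/matrixP => i j; rewrite !mxE.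
  rewrite {1}(mup (enum_val i)) /point_mass (inj_eq enum_val_inj) eq_sym.
  rewrite (sum_enum_val (fun s => mu _ s * _)).
  under [X in _ - _ * X]eq_bigr do rewrite !mxE.
  by rewrite addrK.
have PX := mulmx1C XP.
exists (fun s => (X *m w) (enum_rank s) 0) => s.
have : (1%:M - gamma M *: P) *m X *m w = w by rewrite PX mul1mx.
rewrite -mulmxA mulmxBl mul1mx -scalemxAl => /matrixP /(_ (enum_rank s) 0).
move: (X *m w) => y; rewrite !mxE enum_rankK => /eqP.
rewrite subr_eq => /eqP ->; congr (_ + _ * _).
rewrite [RHS]sum_enum_val; apply: eq_bigr => j _.
by rewrite !mxE enum_rankK enum_valK.
Qed.

(** No relation between [v] and [pi'] is required; the applications take for [v]
    the value function of another policy. *)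
Lemma performance_difference pi' g' v rho mu' :
  is_visitation pi' rho mu' ->
  \sum_s mu' s * g' s - \sum_s rho s * v s =
  \sum_s mu' s * (g' s + gamma M * (\sum_s' kernel pi' s s' * v s') - v s).
Proof.
move=> mup.
have -> : \sum_s rho s * v s = \sum_s mu' s * v s
    - gamma M * \sum_s mu' s * \sum_s' kernel pi' s s' * v s'.
  transitivity (\sum_s' (mu' s' * v s' -
                 gamma M * ((\sum_s mu' s * kernel pi' s s') * v s'))).
    by apply: eq_bigr => s' _; rewrite {1}mup; ring.
  rewrite big_split/= sumrN -mulr_sumr; congr (_ - _ * _).
  transitivity (\sum_s' \sum_s (mu' s * kernel pi' s s') * v s').
    by apply: eq_bigr => s' _; rewrite mulr_suml.
  rewrite exchange_big/=; apply: eq_bigr => s _; rewrite mulr_sumr.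
  by apply: eq_bigr => s' _; rewrite mulrA.
rewrite mulr_sumr -!sumrB; apply: eq_bigr => s _; ring.
Qed.

Lemma visitation_bellman pi g v rho mu :
  is_bellman pi g v -> is_visitation pi rho mu ->
  \sum_s mu s * g s = \sum_s rho s * v s.
Proof.
move=> vb mup; apply/eqP; rewrite -subr_eq0 (performance_difference g v mup).
by rewrite big1// => s _; rewrite {1}vb; ring.
Qed.

(** The difference of the two flow equations is a contraction of factor [gamma]
    in l1 norm, up to a term controlled by the difference of the policies. *)
Lemma visitation_lipschitz pi pi' rho mu mu' :
  is_policy pi -> is_policy pi' -> is_distr rho ->
  is_visitation pi rho mu -> is_visitation pi' rho mu' ->
  (forall s, 0 <= mu' s) ->
  \sum_s `|mu' s - mu s| <=
  gamma M / (1 - gamma M) ^+ 2 * \sum_s \sum_a `|pi' s a - pi s a|.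
Proof.
move=> pip pip' rhod mup mup' mu0.
have g0 := gamma_ge0; have g1 := gamma_lt1.
have g1' : 0 < 1 - gamma M by rewrite subr_gt0.
set d := \sum_s \sum_a _; set D := \sum_s _.
have Dle : D <= gamma M * D + gamma M * ((1 - gamma M)^-1 * d).
  have le1 s' : `|mu' s' - mu s'| <=
      gamma M * (\sum_s `|mu' s - mu s| * kernel pi s s') +
      gamma M * (\sum_s mu' s * \sum_a `|pi' s a - pi s a| * trans M s a s').
    have -> : mu' s' - mu s' = gamma M * (\sum_s (mu' s - mu s) * kernel pi s s')
        + gamma M * (\sum_s mu' s * \sum_a (pi' s a - pi s a) * trans M s a s').
      rewrite {1}mup {1}mup' opprD addrACA subrr add0r -mulrDr -mulrBr -sumrB -big_split/=.
      congr (_ * _); apply: eq_bigr => s _.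
      have -> : \sum_a (pi' s a - pi s a) * trans M s a s' =
          kernel pi' s s' - kernel pi s s'.
        by rewrite /kernel -sumrB; apply: eq_bigr => a _; rewrite mulrBl.
      by ring.
    apply: (le_trans (ler_normD _ _)); rewrite !normrM !(ger0_norm g0).
    apply: lerD; apply: ler_wpM2l => //; apply: (le_trans (ler_norm_sum _ _ _));
      apply: ler_sum => s _; rewrite normrM.
      by rewrite (ger0_norm (kernel_ge0 _ _ pip)).
    rewrite (ger0_norm (mu0 s)) ler_wpM2l//.
    apply: (le_trans (ler_norm_sum _ _ _)); apply: ler_sum => a _.
    by rewrite normrM (ger0_norm ((trans_distr M s a).1 s')).
  apply: (le_trans (ler_sum _ (fun s _ => le1 s))).
  rewrite big_split/= -!mulr_sumr; apply: lerD; apply: ler_wpM2l => //.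
    rewrite exchange_big/=; apply: ler_sum => s _.
    by rewrite -mulr_sumr sum_kernel_distr// mulr1.
  rewrite exchange_big/= -(sum_visitation pip' rhod mup') mulr_suml.
  apply: ler_sum => s _; rewrite -mulr_sumr ler_wpM2l//.
  rewrite exchange_big/=.
  have -> : \sum_a \sum_s' `|pi' s a - pi s a| * trans M s a s' =
      \sum_a `|pi' s a - pi s a|.
    apply: eq_bigr => a _.
    by rewrite -mulr_sumr (trans_distr M s a).2 mulr1.
  by rewrite /d (bigD1 s)//= lerDl; apply: sumr_ge0 => i _; apply: sumr_ge0.
rewrite -(ler_pM2l g1') (le_trans (_ : _ <= gamma M * ((1 - gamma M)^-1 * d)))//.
  by rewrite mulrBl mul1r lerBlDl.
by rewrite le_eqVlt; apply/orP; left; apply/eqP; field; rewrite gt_eqF.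
Qed.

End dynamics.

(** * Measure-theoretic and series lemmas *)

Lemma measure_partition d (Omega : measurableType d) (R : realType)
    (P : {measure set Omega -> \bar R}) (T : finType) (E : set Omega)
    (F : T -> set Omega) :
  (forall x, measurable (F x)) -> trivIset setT F -> E = \bigcup_x F x ->
  P E = (\sum_x P (F x))%E.
Proof.
move=> mF tF ->.
have -> : \bigcup_x F x = \big[setU/set0]_(i < #|T| | true) F (enum_val i).
  rewrite -bigcup_seq; apply/seteqP; split => [w [x _ Fx]|w [i _ Fi]].
    by exists (enum_rank x); rewrite ?enum_rankK//= mem_index_enum.
  by exists (enum_val i).
rewrite measure_bigsetU_ord//.
  by rewrite (reindex (@enum_val T predT))//; apply: onW_bij; exact: enum_val_bij.
by move=> i j _ _ /(tF _ _ I I) /enum_val_inj.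
Qed.

Section integral_lemmas.
Context d (Omega : measurableType d) (R : realType) (P : probability Omega R).

Import HBNNSimple.

(** No measurability of [h] is needed: the integral of its negative part is the
    supremum of the integrals of the simple functions below it, hence +oo; the
    positive part is irrelevant, as +oo - +oo is -oo. *)
Lemma integral_Ny (E : set Omega) (h : Omega -> \bar R) :
  measurable E -> P E = 1%E -> (forall w, E w -> h w = -oo%E) ->
  (\int[P]_w h w = -oo)%E.
Proof.
move=> mE PE hE; rewrite integralE.
suff -> : (\int[P]_x (h^\- x) = +oo)%E by rewrite addeNy.
apply/eqyP => C C0.
pose phi : {nnsfun Omega >-> R} := scale_nnsfun (indic_nnsfun R mE) (ltW C0).
have phiE w : phi w = C * \1_E w by [].
have -> : C%:E = (\int[P]_w (phi w)%:E)%E.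
  under eq_integral do rewrite phiE EFinM.
  rewrite integralZl//; last exact: integrable_indic.
  transitivity (C%:E * P E)%E; first by rewrite PE mule1.
  by rewrite integral_indic// setIT.
rewrite integralT_nnsfun ge0_integralTE//; apply: ereal_sup_ubound.
exists phi => // w; rewrite phiE indicE.
have [/set_mem Ew|_] := boolP (w \in E); last by rewrite mulr0 funeneg_ge0.
by rewrite mulr1 funenegE hE//= le_max leey.
Qed.

(** Transfer formula for a random variable with finitely many values. *)
Lemma integral_finite (T : finType) (Y : Omega -> T) (k : T -> R) :
  (forall y, measurable [set w | Y w = y]) ->
  P.-integrable setT (fun w => (k (Y w))%:E) /\
  (\int[P]_w (k (Y w))%:E = \sum_y (k y)%:E * P [set w | Y w = y])%E.
Proof.
move=> mY.
have intE y : P.-integrable setT (fun w => (k y)%:E * (\1_[set w | Y w = y] w)%:E)%E.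
  by apply: integrableZl => //; apply: integrable_indic.
have -> : (fun w => (k (Y w))%:E) =
    (fun w => \sum_y (k y)%:E * (\1_[set w | Y w = y] w)%:E)%E.
  apply/funext => w; rewrite (bigD1 (Y w))//= big1 ?adde0.
    by rewrite indicE mem_set// mule1.
  move=> y yY; rewrite indicE memNset ?mule0// => /= e.
  by rewrite e eqxx in yY.
split; first exact: integrable_sum.
rewrite integral_sum//; apply: eq_bigr => y _.
rewrite integralZl//; last exact: integrable_indic.
by rewrite integral_indic// setIT.
Qed.

End integral_lemmas.

Section discounted_series.
Variables (R : realType) (c : R).
Hypothesis c01 : 0 <= c < 1.

(** Discounted sums of a bounded sequence converge, with bounded partial sums. *)
Lemma discounted_cvg (K : R) (x : R^nat) : (forall t, `|x t| <= K) ->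
  cvgn (series (fun t => c ^+ t * x t)) /\
  forall n, `|series (fun t => c ^+ t * x t) n| <= K / (1 - c).
Proof.
move=> xK; have /andP[c0 c1] := c01.
have nc1 : `|c| < 1 by rewrite ger0_norm.
have K0 : 0 <= K by apply: le_trans (xK 0%N).
have le t : `|c ^+ t * x t| <= geometric K c t.
  by rewrite normrM ger0_norm ?exprn_ge0// mulrC ler_wpM2r ?exprn_ge0.
have cg := cvg_geometric_series (a := K) nc1.
have nd : nondecreasing_seq (series (geometric K c)).
  by apply: nondecreasing_series => t _ _; rewrite mulr_ge0 ?exprn_ge0.
split.
  apply: normed_cvg; apply: series_le_cvg le _ => //.
    by move=> t; rewrite /= mulr_ge0 ?exprn_ge0.
  exact: is_cvg_geometric_series.
move=> n; apply: le_trans (_ : series (geometric K c) n <= _).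
  by rewrite /series/=; apply: (le_trans (ler_norm_sum _ _ _)); apply: ler_sum => t _; exact: le.
rewrite -(cvg_lim _ cg)//; apply: nondecreasing_cvgn_le => //.
exact: is_cvg_geometric_series.
Qed.

End discounted_series.

Lemma cvg_finsum (R : realType) (U : Type) (F : set_system U) {FF : Filter F}
    (I : Type) (r : seq I) (f : I -> U -> R) (l : I -> R) :
  (forall i, f i x @[x --> F] --> l i) ->
  \sum_(i <- r) f i x @[x --> F] --> \sum_(i <- r) l i.
Proof.
move=> fl; elim: r => [|i r IH].
  rewrite big_nil; under eq_fun do rewrite big_nil.
  exact: cvg_cst.
rewrite big_cons; under eq_fun do rewrite big_cons.
by apply: cvgD; [exact: fl|exact: IH].
Qed.

(** * State distributions and value of a policy *)

Section process.
Variables (R : realType) (S A : finType) (M : mdp R S A) (X : mdp_process M).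
Variables (pi : S -> A -> R) (rho : S -> R).
Hypotheses (pip : is_policy pi) (rhod : is_distr rho).

(** [marginal t s] is the probability of being in [s] at time [t], given by the
    forward recursion; [law_state] identifies it. *)
Fixpoint marginal (t : nat) (s : S) : R :=
  if t is t'.+1 then \sum_s0 marginal t' s0 * kernel M pi s0 s else rho s.

Lemma marginal_ge0 t s : 0 <= marginal t s.
Proof.
elim: t s => [|t IH] s /=; first exact: rhod.1.
by apply: sumr_ge0 => s0 _; rewrite mulr_ge0// kernel_ge0.
Qed.

Lemma sum_marginal t : \sum_s marginal t s = 1.
Proof.
elim: t => [|t IH] /=; first exact: rhod.2.
rewrite exchange_big/= -IH; apply: eq_bigr => s _.
by rewrite -mulr_sumr sum_kernel_distr// mulr1.
Qed.

Lemma marginal_le1 t s : marginal t s <= 1.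
Proof.
rewrite -(sum_marginal t) (bigD1 s)//= lerDl.
by apply: sumr_ge0 => i _; exact: marginal_ge0.
Qed.

Let history (k n : nat) (hs : nat -> S) (ha : nat -> A) : set (sample X) :=
  [set w | forall t, (k <= t <= n)%N -> state t w = hs t /\ action t w = ha t].

Lemma measurable_state_action t s a :
  measurable [set w : sample X | state t w = s /\ action t w = a].
Proof.
have -> : [set w : sample X | state t w = s /\ action t w = a] =
  [set w | state t w = s] `&` [set w | action t w = a] by [].
by apply: measurableI; [exact: measurable_state|exact: measurable_action].
Qed.

Let measurable_history k n hs ha : measurable (history k n hs ha).
Proof.
have -> : history k n hs ha = \bigcap_t
    (if (k <= t <= n)%N then [set w | state t w = hs t /\ action t w = ha t]
     else setT).
  apply/seteqP; split => [w Hw t _|w Hw t tkn].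
    by case: ifP => // tkn; exact: Hw.
  by move: (Hw t I); rewrite tkn.
apply: bigcapT_measurable => t; case: ifP => _; last exact: measurableT.
exact: measurable_state_action.
Qed.

(** The law of the history from time [k] on.  The induction on [k] sums over the
    state and action at time [k]; only the case [k = n] is used in the end, but
    the induction needs all later times. *)
Let law_history_from k n hs ha : (k <= n)%N ->
  law X pi rho (history k n hs ha) =
  (marginal k (hs k) * pi (hs k) (ha k) *
   \prod_(k <= t < n) (trans M (hs t) (ha t) (hs t.+1) *
                       pi (hs t.+1) (ha t.+1)))%:E.
Proof.
elim: k hs ha => [|k IH] hs ha kn.
  by rewrite big_mkord -(law_history X pip rhod).
(* The histories [hs], [ha] with their time [k] entries replaced. *)
pose us (s : S) t := if t == k then s else hs t.
pose ua (a : A) t := if t == k then a else ha t.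
rewrite (@measure_partition _ _ _ _ (S * A)%type _
  (fun sa => history k n (us sa.1) (ua sa.2))).
- transitivity (\sum_sa (marginal k sa.1 * pi sa.1 sa.2 *
     (trans M sa.1 sa.2 (hs k.+1) * pi (hs k.+1) (ha k.+1) *
   \prod_(k.+1 <= t < n) (trans M (hs t) (ha t) (hs t.+1) *
                       pi (hs t.+1) (ha t.+1))))%:E)%E.
    apply: eq_bigr => -[s a] _ /=; rewrite IH; last exact: ltnW.
    rewrite /us /ua eqxx big_ltn// eqxx gtn_eqF//; congr (_ * (_ * _))%:E.
    apply: eq_big_nat => t /andP[kt _].
    by rewrite !gtn_eqF// ltnW.
  rewrite sumEFin; congr _%:E.
  rewrite [LHS](_ : _ = \sum_s \sum_a (marginal k s * pi s a *
     (trans M s a (hs k.+1) * pi (hs k.+1) (ha k.+1) *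
   \prod_(k.+1 <= t < n) (trans M (hs t) (ha t) (hs t.+1) *
                       pi (hs t.+1) (ha t.+1))))); last by rewrite pair_bigA.
  rewrite /= -mulrA mulr_suml; apply: eq_bigr => s _.
  rewrite /kernel mulr_sumr mulr_suml; apply: eq_bigr => a _; ring.
- by move=> sa; exact: measurable_history.
- move=> [s a] [s' a'] _ _ [w [/= H1 H2]].
  have := H1 k; have := H2 k; rewrite leqnn ltnW// => /(_ isT) [].
  by rewrite /us /ua eqxx => -> -> /(_ isT) [-> ->].
- apply/seteqP; split => [w Hw|w [[s a] _ /= Hw] t /andP[kt tn]].
    exists (state k w, action k w) => //= t /andP[kt tn].
    rewrite /us /ua; case: eqP => [->//|tk]; apply: Hw.
    by rewrite tn andbT ltn_neqAle kt andbT; apply/eqP => e; rewrite e in tk.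
  by have := Hw t; rewrite /us /ua gtn_eqF// tn (ltnW kt); apply.
Qed.

Lemma law_state_action t s a :
  law X pi rho [set w | state t w = s /\ action t w = a] =
  (marginal t s * pi s a)%:E.
Proof.
have := law_history_from (fun=> s) (fun=> a) (leqnn t).
rewrite big_geq// mulr1 => <-; congr (law _ _ _ _).
apply/seteqP; split => [w [ws wa] t' /andP[]|w /(_ t)]; last first.
  by rewrite leqnn; exact.
by move=> h1 h2; have -> : t' = t by apply/eqP; rewrite eqn_leq h1 h2.
Qed.

Lemma law_state t s : law X pi rho [set w | state t w = s] = (marginal t s)%:E.
Proof.
rewrite (@measure_partition _ _ _ _ A _
  (fun a => [set w | state t w = s /\ action t w = a])).
- transitivity (\sum_a (marginal t s * pi s a)%:E)%E.
    by apply: eq_bigr => a _; exact: law_state_action.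
  by rewrite sumEFin -mulr_sumr (pip s).2 mulr1.
- by move=> a; exact: measurable_state_action.
- by move=> a a' _ _ [w [[_ <-] [_ <-]]].
- apply/seteqP; split => [w ws|w [a _ []//]]; by exists (action t w).
Qed.

(** [visitation s] is the expected discounted number of visits to [s], that is
    the occupancy without its normalizing factor [1 - gamma]. *)
Definition visitation (s : S) : R :=
  limn (series (fun t => gamma M ^+ t * marginal t s)).

Lemma occupancyE s : occupancy X pi rho s = (1 - gamma M) * visitation s.
Proof.
rewrite /occupancy /visitation.
have -> // : (fun t => gamma M ^+ t *
    fine (law X pi rho [set w | state t w = s])) =
  (fun t => gamma M ^+ t * marginal t s).
by apply/funext => t; rewrite law_state.
Qed.

Lemma marginal_norm t s : `|marginal t s| <= 1.
Proof. by rewrite ger0_norm ?marginal_le1 ?marginal_ge0. Qed.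

Lemma visitation_cvg s :
  series (fun t => gamma M ^+ t * marginal t s) @ \oo --> visitation s.
Proof. exact: (discounted_cvg (gamma_bounds M) (fun t => marginal_norm t s)).1. Qed.

Lemma visitation_ge0 s : 0 <= visitation s.
Proof.
apply: (cvgr_to_ge (visitation_cvg (s := s))); near=> n.
by rewrite /series/=; apply: sumr_ge0 => t _; rewrite mulr_ge0 ?marginal_ge0 ?exprn_ge0 ?gamma_ge0.
Unshelve. all: by end_near. Qed.

(** The flow equation, by shifting the series by one step. *)
Lemma visitationP : is_visitation M pi rho visitation.
Proof.
move=> s'.
have c1 : (fun n => series (fun t => gamma M ^+ t * marginal t s') n.+1) @ \oo
    --> visitation s'.
  by have := @visitation_cvg s'; rewrite -cvg_shiftS.
have c2 : (fun n => rho s' + gamma M * \sum_s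
    (series (fun t => gamma M ^+ t * marginal t s) n) * kernel M pi s s') @ \oo
    --> rho s' + gamma M * \sum_s visitation s * kernel M pi s s'.
  apply: cvgD; first exact: cvg_cst.
  apply: cvgM; first exact: cvg_cst.
  apply: cvg_finsum => s; apply: cvgM; last exact: cvg_cst.
  exact: visitation_cvg.
apply: (cvg_unique _ c1); rewrite //.
apply: cvg_trans c2; apply: near_eq_cvg; near=> n.
rewrite /series/= big_nat_recl//= expr0 mul1r; congr (_ + _).
rewrite mulr_sumr.
transitivity (\sum_s \sum_(0 <= t < n)
    gamma M * (gamma M ^+ t * marginal t s * kernel M pi s s')).
  by apply: eq_bigr => s _; rewrite mulr_suml mulr_sumr.
rewrite exchange_big/=; apply: eq_bigr => t _; rewrite mulr_sumr.
by apply: eq_bigr => s _; rewrite exprS; ring.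
Unshelve. all: by end_near. Qed.

Section value.
Variables (f : R -> R) (lambda : R) (pref : S -> A -> R).

(** When all divergences are finite, the discounted sums are bounded and dominated
    convergence exchanges the integral and the series. *)
Lemma value_finE (D : S -> R) :
  (forall s, fdiv f (pi s) (pref s) = (D s)%:E) ->
  value X f lambda pref pi rho =
  (\sum_s visitation s * \sum_a pi s a * (reward M s a - lambda * D s))%:E.
Proof.
move=> fD.
pose k (y : S * A) := reward M y.1 y.2 - lambda * D y.1.
pose Y t (w : sample X) := (state t w, action t w).
set c := gamma M.
have [K Kk] : exists K, forall y, `|k y| <= K.
  exists (\sum_y `|k y|) => y; rewrite (bigD1 y)//= lerDl.
  exact: sumr_ge0.
have mY t y : measurable [set w | Y t w = y].
  have -> : [set w | Y t w = y] = [set w | state t w = y.1 /\ action t w = y.2].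
    case: y => s a; apply/seteqP; split => w /=; first by case.
    by move=> [? ?]; congr (_, _).
  exact: measurable_state_action.
pose x (w : sample X) t := k (Y t w).
pose F n (w : sample X) : \bar R := (series (fun t => c ^+ t * x w t) n)%:E.
pose h (w : sample X) := (\sum_(0 <= t <oo) (c ^+ t)%:E *
  ((reward M (state t w) (action t w))%:E -
   lambda%:E * fdiv f (pi (state t w)) (pref (state t w))))%E.
have xK w t : `|x w t| <= K by exact: Kk.
have dc w := discounted_cvg (gamma_bounds M) (xK w).
have Fh w : F ^~ w @ \oo --> h w.
  have c1 : F ^~ w @ \oo --> (limn (series (fun t => c ^+ t * x w t)))%:E.
    by apply: cvg_EFin; [near=> n|exact: (dc w).1].
  suff -> : h w = (limn (series (fun t => c ^+ t * x w t)))%:E by [].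
  rewrite /h; apply/cvg_lim => //.
  apply: cvg_trans c1; apply: near_eq_cvg; near=> n.
  rewrite /F /series/= -sumEFin; apply: eq_bigr => t _.
  by rewrite fD /x /k /Y /= EFinM EFinB EFinM.
have FE n w : F n w = (\sum_(0 <= t < n) (c ^+ t)%:E * (k (Y t w))%:E)%E.
  by rewrite /F /series/= -sumEFin; apply: eq_bigr => t _; rewrite EFinM.
have Fint t : (law X pi rho).-integrable setT
    (fun w => (c ^+ t)%:E * (k (Y t w))%:E)%E.
  by apply: integrableZl => //; exact: (integral_finite (law X pi rho) k (mY t)).1.
have IF n : (\int[law X pi rho]_w F n w)%E =
    (\sum_s series (fun t => c ^+ t * marginal t s) n *
       \sum_a pi s a * (reward M s a - lambda * D s))%:E.
  transitivity (\int[law X pi rho]_w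
      (\sum_(0 <= t < n) (c ^+ t)%:E * (k (Y t w))%:E)%E)%E.
    by apply: eq_integral => w _; exact: FE.
  rewrite integral_sum//.
  transitivity (\sum_(0 <= t < n)
      (c ^+ t * \sum_s \sum_a k (s, a) * (marginal t s * pi s a))%:E)%E.
    apply: eq_bigr => t _; rewrite integralZl//; last first.
      exact: (integral_finite (law X pi rho) k (mY t)).1.
    rewrite (integral_finite (law X pi rho) k (mY t)).2 EFinM; congr (_ * _)%E.
    rewrite pair_bigA/= -sumEFin; apply: eq_bigr => -[s a] _; rewrite EFinM.
    congr (_ * _)%E; rewrite -law_state_action; congr (law _ _ _ _).
    apply/seteqP; split => w /=; first by case.
    by move=> [? ?]; congr (_, _).
  rewrite sumEFin; congr _%:E; rewrite /series/=.
  transitivity (\sum_(0 <= t < n) \sum_s c ^+ t * marginal t s *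
      \sum_a pi s a * (reward M s a - lambda * D s)).
    apply: eq_bigr => t _; rewrite mulr_sumr; apply: eq_bigr => s _.
    by rewrite !mulr_sumr; apply: eq_bigr => a _; rewrite /k /=; ring.
  by rewrite exchange_big/=; apply: eq_bigr => s _; rewrite mulr_suml.
have cI : (\int[law X pi rho]_w F n w)%E @[n --> \oo] -->
    (\int[law X pi rho]_w h w)%E.
  apply: (@dominated_cvg _ _ _ _ _ measurableT F h (fun=> (K / (1 - c))%:E)) => //.
  - move=> n; rewrite (_ : F n = fun w =>
      (\sum_(0 <= t < n) (c ^+ t)%:E * (k (Y t w))%:E)%E); last first.
      by apply/funext => w; exact: FE.
    by apply: measurable_int; apply: integrable_sum.
  - by apply: finite_measure_integrable_cst.
  - by move=> n w _; rewrite /F /= lee_fin; exact: (dc w).2.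
have cJ : (\int[law X pi rho]_w F n w)%E @[n --> \oo] -->
  (\sum_s visitation s * \sum_a pi s a * (reward M s a - lambda * D s))%:E.
  under eq_fun do rewrite IF.
  apply: cvg_EFin; first by near=> n.
  apply: cvg_finsum => s; apply: cvgM; last exact: cvg_cst.
  exact: visitation_cvg.
exact: (cvg_unique _ cI cJ).
Unshelve. all: by end_near. Qed.

(** An infinite divergence at the initial state makes the first summand, hence
    every later partial sum, equal to -oo, which absorbs any other value. *)
Lemma value_Ny (s : S) : 0 < lambda ->
  rho = point_mass R s -> fdiv f (pi s) (pref s) = +oo%E ->
  value X f lambda pref pi rho = -oo%E.
Proof.
move=> l0 rhoE fs.
apply: (@integral_Ny _ _ _ _ [set w | state 0 w = s]).
- exact: measurable_state.
- by rewrite law_state/= rhoE /point_mass eqxx.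
move=> w ws.
pose u t := ((gamma M ^+ t)%:E *
  ((reward M (state t w) (action t w))%:E -
   lambda%:E * fdiv f (pi (state t w)) (pref (state t w))))%E.
have u0 : u 0%N = -oo%E.
  by rewrite /u expr0 mul1e ws fs gt0_muley ?lte_fin// addeNy.
apply: cvg_lim => //; apply: cvg_near_cst; exists 1%N => // n /= n1.
apply/esum_eqNyP; exists 0%N; split => //.
by rewrite mem_index_iota.
Qed.

End value.

End process.

(** * Differentiation of the softmax parametrization *)

Section diff_mul_zero.
Variables (R : realType) (V : normedModType R) (k phi : V -> R) (x : V).
Hypotheses (kx : {for x, continuous k}) (dphi : differentiable phi x)
  (phix : phi x = 0).

(** Product rule at a zero of [phi]: continuity of [k] is enough, and [k] is not
    differentiated. *)
Lemma diff_mul_zero :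
  differentiable (fun y => k y * phi y) x /\
  forall v, 'd (fun y => k y * phi y) x v = k x * 'd phi x v.
Proof.
pose df : {linear V -> R} := k x \*: ('d phi x).
have dfc : continuous df.
  move=> y; apply: continuousM; first exact: cst_continuous.
  exact: diff_continuous.
have expand : (fun y => k y * phi y) \o shift x =
    cst ((fun y => k y * phi y) x) + (df : V -> R) +o_ 0 id.
  apply/eqaddoP => e e0.
  have [C C0 HC] := linear_lipschitz (diff_continuous dphi).
  have C1 : 0 < C + 1 by rewrite addr_gt0.
  have K1 : 0 < `|k x| + 1 by rewrite ltr_wpDl.
  (* The bound 1 on [e1] gives |phi (v + x)| <= (C + 1) |v|; the other bound makes
     the contribution of the remainder of [phi] at most e / 2 |v|. *)
  pose e1 := Num.min 1 (e / 2 / (`|k x| + 1)).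
  have e10 : 0 < e1 by rewrite lt_min ltr01 !divr_gt0.
  have /eqaddoP/(_ _ e10) ph := diff_locally dphi.
  pose e2 := e / 2 / (C + 1).
  have e20 : 0 < e2 by rewrite !divr_gt0.
  have /cvgrPdist_le/(_ _ e20) kh : k (y + x) @[y --> (0 : V)] --> k x.
    rewrite -[in X in _ --> X](add0r x); apply: (@continuous_comp _ _ _ (shift x) k).
      by apply: continuousD; [exact: cvg_id|exact: cst_continuous].
    by rewrite /= add0r.
  near=> v.
  have H1 : `|phi (v + x) - 'd phi x v| <= e1 * `|v|.
    have : `|(phi \o shift x - (cst (phi x) + ('d phi x : V -> R))) v| <= e1 * `|v|.
      by near: v; exact: ph.
    by rewrite !fctE /= phix add0r.
  have H2 : `|k x - k (v + x)| <= e2 by near: v; exact: kh.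
  have H3 : `|phi (v + x)| <= (C + 1) * `|v|.
    rewrite -[phi _](subrK ('d phi x v)); apply: (le_trans (ler_normD _ _)).
    rewrite mulrDl mul1r addrC lerD//; apply: (le_trans H1).
    by rewrite ler_piMl// ge_min lexx.
  rewrite !fctE /= phix mulr0 add0r.
  rewrite (_ : _ - _ = (k (v + x) - k x) * phi (v + x)
      + k x * (phi (v + x) - 'd phi x v)); last first.
    by rewrite -[_ *: _]/(k x * _); ring.
  apply: (le_trans (ler_normD _ _)); rewrite !normrM.
  rewrite (_ : e * `|v| = e2 * ((C + 1) * `|v|)
      + (`|k x| + 1) * (e / 2 / (`|k x| + 1) * `|v|)); last first.
    by rewrite /e2; field; rewrite !gt_eqF.
  apply: lerD; first by rewrite ler_pM// distrC.
  apply: ler_pM => //; first by rewrite lerDl.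
  by apply: (le_trans H1); rewrite ler_wpM2r// ge_min lexx orbT.
have dE := diff_unique dfc expand.
split; last by move=> v; rewrite dE.
by apply/diff_locallyP; rewrite dE.
Unshelve. all: by end_near. Qed.

End diff_mul_zero.

Section finite_sums.
Variables (R : realType) (V : normedModType R).

Lemma differentiable_finsum (I : Type) (r : seq I) (F : I -> V -> R) (x : V) :
  (forall i, differentiable (F i) x) ->
  differentiable (fun y => \sum_(i <- r) F i y) x /\
  forall v, 'd (fun y => \sum_(i <- r) F i y) x v = \sum_(i <- r) 'd (F i) x v.
Proof.
move=> dF; elim: r => [|i r [IH1 IH2]].
  rewrite (_ : (fun _ => _) = cst 0); last by apply/funext => y; rewrite big_nil.
  by split => // v; rewrite diff_cst big_nil.
rewrite (_ : (fun _ => _) = F i + fun y => \sum_(i <- r) F i y); last first.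
  by apply/funext => y; rewrite big_cons.
split; first exact: differentiableD.
by move=> v; rewrite diffD// big_cons -IH2.
Qed.

Lemma diff_outer (g : R -> R) (F : V -> R) (x : V) :
  differentiable F x -> derivable g (F x) 1 ->
  differentiable (fun y => g (F y)) x /\
  forall v, 'd (fun y => g (F y)) x v = g^`()%classic (F x) * 'd F x v.
Proof.
move=> dF dg; have /derivable1_diffP dg' := dg.
split; first exact: (differentiable_comp dF dg').
move=> v; rewrite (diff_comp dF dg')/=.
by rewrite -deriveE// (derive1_dir _ dg).2.
Qed.

End finite_sums.

Section softmax.
Variables (R : realType) (S A : finType).
Notation Theta := 'M[R]_(#|S|, #|A|).
Implicit Type theta : Theta.

Lemma softmax_denom_gt0 theta s (a : A) :
  0 < \sum_(b : A) expR (theta (enum_rank s) (enum_rank b)).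
Proof.
by rewrite (bigD1 a)//= ltr_pwDl ?expR_gt0// sumr_ge0// => b _; exact: expR_ge0.
Qed.

Lemma softmax_gt0 theta s a : 0 < softmax theta s a.
Proof. by rewrite divr_gt0 ?expR_gt0// (softmax_denom_gt0 _ _ a). Qed.

Lemma softmax_policy theta (a : A) : is_policy (softmax theta).
Proof.
move=> s; split => [b|]; first exact/ltW/softmax_gt0.
by rewrite -mulr_suml mulfV// gt_eqF// (softmax_denom_gt0 _ _ a).
Qed.

Lemma diff_softmax theta s (a : A) :
  differentiable (fun t : Theta => softmax t s a) theta /\
  forall v : Theta, 'd (fun t : Theta => softmax t s a) theta v =
    softmax theta s a * (v (enum_rank s) (enum_rank a) -
      \sum_b softmax theta s b * v (enum_rank s) (enum_rank b)).
Proof.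
pose co b (t : Theta) : R := t (enum_rank s) (enum_rank b).
have dco b : differentiable (co b) theta by exact: differentiable_coord.
have dcoE b v : 'd (co b) theta v = co b v.
  rewrite -deriveE//; apply: cvg_lim => //.
  have cc : (fun=> co b v) h @[h --> (0 : R)^'] --> co b v by exact: cvg_cst.
  apply: cvg_trans cc; apply: near_eq_cvg; near=> h.
  have h0 : h != 0 by near: h; exact: nbhs_dnbhs_neq.
  by rewrite /co /= !mxE addrK /GRing.scale/= mulKf.
pose e b (t : Theta) : R := expR (co b t).
have dexp b : differentiable (e b) theta /\
    forall v, 'd (e b) theta v = expR^`()%classic (co b theta) * 'd (co b) theta v.
  by apply: diff_outer; [exact: dco|exact: derivable_expR].
have de b : differentiable (e b) theta by exact: (dexp b).1.
have deE b v : 'd (e b) theta v = e b theta * co b v.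
  by rewrite (dexp b).2 derive1E derive_val dcoE.
pose Z (t : Theta) : R := \sum_b e b t.
have dZ : differentiable Z theta := (differentiable_finsum (index_enum A) de).1.
have dZE v : 'd Z theta v = \sum_b e b theta * co b v.
  rewrite (differentiable_finsum (index_enum A) de).2; apply: eq_bigr => b _.
  exact: deE.
have Z0 : Z theta != 0 by rewrite gt_eqF// (softmax_denom_gt0 _ _ a).
have -> : (fun t : Theta => softmax t s a) = e a * (fun t => (Z t)^-1) by [].
have dV : differentiable (fun t => (Z t)^-1) theta by exact: differentiableV.
split; first exact: differentiableM.
move=> v.
have -> : 'd (e a * (fun t : Theta => (Z t)^-1)) theta v =
    e a theta * 'd (fun t => (Z t)^-1) theta v + (Z theta)^-1 * 'd (e a) theta v.
  by rewrite (diffM (de a) dV).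
have -> : 'd (fun t : Theta => (Z t)^-1) theta v = - (Z theta) ^- 2 * 'd Z theta v.
  by rewrite (diffV dZ Z0).
rewrite deE dZE.
have softE b : softmax theta s b = e b theta / Z theta by [].
have -> : \sum_b softmax theta s b * v (enum_rank s) (enum_rank b) =
    (\sum_b e b theta * co b v) / Z theta.
  by rewrite mulr_suml; apply: eq_bigr => b _; rewrite softE mulrAC.
rewrite softE -/(co a v).
by field.
Unshelve. all: by end_near. Qed.

End softmax.

(** * One-step gap and algebraic comparison *)

Section regularized_gap.
Variables (R : realType) (T : finType) (f : R -> R) (q p p' Q : T -> R)
  (lambda m : R).
Hypotheses (gf : is_generator f) (q0 : forall x, 0 < q x)
  (pd : is_distr p) (p0 : forall x, 0 < p x) (p'd : is_distr p')
  (fin : forall x, generator0 f (p' x / q x) \is a fin_num)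
  (l0 : 0 < lambda) (m0 : 0 < m)
  (hm : forall r x, is_distr r -> 0 < r x ->
        m <= f^`(2)%classic (r x / q x) * (1 / q x)).

Lemma between_conv (x y z : R) : Num.min x y <= z <= Num.max x y ->
  exists2 t, 0 <= t <= 1 & z = (1 - t) * x + t * y.
Proof.
wlog xy : x y / x <= y.
  move=> H; have [xy|yx] := leP x y; first by move: (H x y xy); rewrite min_l// max_r.
  have := H y x (ltW yx); rewrite min_l ?(ltW yx)// max_r ?(ltW yx)// => H' zyx.
  have [t /andP[t0 t1] ->] := H' zyx.
  by exists (1 - t); [apply/andP; split; lra|ring].
rewrite min_l// max_r// => /andP[xz zy].
have [e|ne] := eqVneq x y.
  exists 1; first by rewrite ler01 lexx.
  by rewrite subrr mul0r add0r mul1r; apply/eqP; rewrite eq_le zy -e xz.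
have yx : 0 < y - x by rewrite subr_gt0 lt_neqAle ne.
exists ((z - x) / (y - x)); last by field; rewrite gt_eqF.
rewrite divr_ge0 ?subr_ge0//= ler_pdivrMr// mul1r; lra.
Qed.

(** Every point between [p' x / q x] and [p x / q x] is [r x / q x] for a
    distribution [r] on the segment from [p'] to [p], so [m] bounds the second
    derivative of [f] there. *)
Lemma generator_gap x :
  f^`()%classic (p x / q x) * (p' x - p x) + m / 2 * (p' x - p x) ^+ 2 <=
  q x * fine (generator0 f (p' x / q x)) - q x * f (p x / q x).
Proof.
have y0 : 0 < p x / q x by rewrite divr_gt0.
have x0 : 0 <= p' x / q x by rewrite divr_ge0 ?p'd.1// ltW.
have curv (z : R) : 0 < z ->
    Num.min (p' x / q x) (p x / q x) <= z <= Num.max (p' x / q x) (p x / q x) ->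
    m * q x <= f^`(2)%classic z.
  move=> z0 /between_conv [t /andP[t0 t1] zE].
  pose r y := (1 - t) * p' y + t * p y.
  have rd : is_distr r.
    split=> [y|].
      by rewrite addr_ge0// mulr_ge0 ?subr_ge0 ?p'd.1// ltW.
    by rewrite big_split/= -!mulr_sumr p'd.2 pd.2; ring.
  have rz : r x / q x = z by rewrite zE /r; field; rewrite gt_eqF.
  have rx : 0 < r x by rewrite -(divfK (lt0r_neq0 (q0 x)) (r x)) rz mulr_gt0.
  by have := hm rd rx; rewrite rz mul1r ler_pdivlMr.
have := strong_tangent gf x0 y0 curv (fin x).
rewrite -(ler_pM2l (q0 x)) => H.
rewrite lerBrDr; apply: le_trans H.
rewrite le_eqVlt; apply/orP; left; apply/eqP; field; by rewrite gt_eqF.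
Qed.

(** A strongly concave function exceeds its value at [p] by at most the squared
    norm of its gradient, divided by twice the concavity constant.  On the simplex
    the gradient may be shifted by a constant, here its mean under [p]. *)
Lemma regularized_gap (G : T -> R) :
  (forall x, G x = Q x - lambda * f^`()%classic (p x / q x)) ->
  (\sum_x p' x * Q x - lambda * fdivr f p' q) -
  (\sum_x p x * Q x - lambda * fdivr f p q) <=
  (\sum_x (G x - \sum_y p y * G y) ^+ 2) / (2 * lambda * m).
Proof.
move=> GE; set b := \sum_y p y * G y.
have lm0 : 0 < lambda * m by rewrite mulr_gt0.
rewrite (fdivr_gt0 f q0 p0) /fdivr.
have -> : \sum_x p' x * Q x - lambda * \sum_x q x * fine (generator0 f (p' x / q x)) -
    (\sum_x p x * Q x - lambda * \sum_x q x * f (p x / q x)) =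
  \sum_x ((p' x - p x) * (Q x - b) - lambda *
    (q x * fine (generator0 f (p' x / q x)) - q x * f (p x / q x))).
  (* The shift by [b] is free, both distributions having the same mass. *)
  have E : \sum_x (p' x - p x) * b = 0.
    by rewrite -mulr_suml sumrB p'd.2 pd.2 subrr mul0r.
  rewrite -[LHS]subr0 -[X in _ - X = _]E !mulr_sumr -!sumrB; apply: eq_bigr => x _; ring.
rewrite mulr_suml; apply: ler_sum => x _.
have H := generator_gap x.
apply: (@le_trans _ _ ((p' x - p x) * (Q x - b) - lambda *
   (f^`()%classic (p x / q x) * (p' x - p x) + m / 2 * (p' x - p x) ^+ 2))).
  by rewrite lerD2l lerN2 ler_pM2l.
rewrite ler_pdivlMr ?mulr_gt0// -subr_ge0.
rewrite [X in 0 <= X](_ : _ = ((G x - b) - lambda * m * (p' x - p x)) ^+ 2).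
  exact: sqr_ge0.
by rewrite GE; field.
Qed.

End regularized_gap.

Section lojasiewicz_algebra.
Variables (R : realType) (S A : finType).
Variables (mu mustar L : S -> R) (pi adv : S -> A -> R).
Variables (lambda c_u c_m pmin K : R).

(** [mustar] and [mu] are the visitations of the optimal and of the current
    policy, [L] stands for the one-step gaps, and the right-hand side is the squared
    norm of the policy gradient. *)
Lemma lojasiewicz_algebra :
  0 < lambda -> 0 < c_u -> 0 < c_m -> 0 <= pmin -> 0 < K ->
  (forall s, c_u <= mu s) ->
  (forall s, 0 <= mustar s <= K * mu s) ->
  (forall s a, pmin <= pi s a) ->
  (forall s, L s <= (\sum_a adv s a ^+ 2) / (2 * lambda * c_m)) ->
  2 * lambda * c_u * c_m * pmin ^+ 2 * K^-1 * (\sum_s mustar s * L s) <=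
  \sum_s \sum_a (mu s * (pi s a * adv s a)) ^+ 2.
Proof.
move=> l0 cu0 cm0 p0 K0 cmu mus ppi HL.
have lc0 : 0 < 2 * lambda * c_m by rewrite !mulr_gt0.
rewrite mulr_sumr; apply: ler_sum => s _.
have N0 : 0 <= \sum_a adv s a ^+ 2 by apply: sumr_ge0 => a _; rewrite sqr_ge0.
have /andP[ms0 msK] := mus s.
have mu0 : 0 <= mu s by apply: (le_trans (ltW cu0)).
have step1 : mustar s * L s <= K * mu s *
    ((\sum_a adv s a ^+ 2) / (2 * lambda * c_m)).
  apply: (le_trans (ler_wpM2l ms0 (HL s))); rewrite ler_wpM2r//.
  by rewrite divr_ge0// ltW.
apply: (@le_trans _ _ (c_u * mu s * pmin ^+ 2 * \sum_a adv s a ^+ 2)).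
  have c0 : 0 <= 2 * lambda * c_u * c_m * pmin ^+ 2 * K^-1.
    by rewrite !mulr_ge0 ?invr_ge0 ?sqr_ge0// ltW.
  apply: (le_trans (ler_wpM2l c0 step1)).
  rewrite le_eqVlt; apply/orP; left; apply/eqP; field.
  by rewrite !gt_eqF.
rewrite mulr_sumr; apply: ler_sum => a _; rewrite !exprMn mulrA.
rewrite ler_wpM2r ?sqr_ge0//; apply: ler_pM.
- by rewrite mulr_ge0// ltW.
- exact: sqr_ge0.
- by rewrite expr2 ler_wpM2r.
- by rewrite ler_sqr ?nnegrE// (le_trans p0).
Qed.

End lojasiewicz_algebra.

(** * Policy gradient *)

Section policy_gradient.
Variables (R : realType) (S A : finType) (M : mdp R S A) (X : mdp_process M).
Variables (f : R -> R) (lambda : R) (pref : S -> A -> R).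
Hypotheses (gf : is_generator f) (pref0 : forall s a, 0 < pref s a).
Notation Theta := 'M[R]_(#|S|, #|A|).

(** Expected one-step reward of [pi] at [s], divergence penalty included. *)
Definition reg_reward (pi : S -> A -> R) (s : S) : R :=
  \sum_a pi s a * (reward M s a - lambda * fdivr f (pi s) (pref s)).

(** One-step lookahead over [v], without the penalty of the current step. *)
Definition action_value (v : S -> R) (s : S) (a : A) : R :=
  reward M s a + gamma M * \sum_s' trans M s a s' * v s'.

(** Partial derivatives, at [pi s], of the concave function
    [p -> sum_a p a * action_value v s a - lambda * D_f(p, pref s)]. *)
Definition local_gradient (pi : S -> A -> R) (v : S -> R) (s : S) (a : A) : R :=
  action_value v s a - lambda * f^`()%classic (pi s a / pref s a).

(** The local gradient centred by its mean under [pi s]. *)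
Definition local_advantage (pi : S -> A -> R) (v : S -> R) (s : S) (a : A) : R :=
  local_gradient pi v s a - \sum_b pi s b * local_gradient pi v s b.

Lemma reg_rewardE (pi : S -> A -> R) v s : is_policy pi ->
  reg_reward pi s + gamma M * \sum_s' kernel M pi s s' * v s' =
  \sum_a pi s a * action_value v s a - lambda * fdivr f (pi s) (pref s).
Proof.
move=> pip; rewrite /reg_reward /action_value.
have -> : \sum_s' kernel M pi s s' * v s' =
    \sum_a pi s a * \sum_s' trans M s a s' * v s'.
  transitivity (\sum_s' \sum_a pi s a * trans M s a s' * v s').
    by apply: eq_bigr => s' _; rewrite mulr_suml.
  rewrite exchange_big/=; apply: eq_bigr => a _; rewrite mulr_sumr.
  by apply: eq_bigr => s' _; rewrite mulrA.
rewrite -[X in _ - X]mul1r -{1}(pip s).2 mulr_suml mulr_sumr -sumrB -big_split/=.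
by apply: eq_bigr => a _; ring.
Qed.

Lemma value_finite (pi : S -> A -> R) rho : is_policy pi -> is_distr rho ->
  (forall s a, generator0 f (pi s a / pref s a) \is a fin_num) ->
  value X f lambda pref pi rho =
  (\sum_s visitation M pi rho s * reg_reward pi s)%:E.
Proof.
move=> pip rhod fin; apply: value_finE => // s.
by apply: fdivE.
Qed.

Lemma generator0_fin (pi : S -> A -> R) : (forall s a, 0 < pi s a) ->
  forall s a, generator0 f (pi s a / pref s a) \is a fin_num.
Proof. by move=> pi0 s a; rewrite generator0_gt0// divr_gt0. Qed.

Lemma visitation_ge (pi : S -> A -> R) rho s : is_policy pi -> is_distr rho ->
  rho s <= visitation M pi rho s.
Proof.
move=> pip rhod; rewrite {1}(visitationP M pip rhod s) lerDl.
rewrite mulr_ge0 ?gamma_ge0// sumr_ge0// => s' _.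
by rewrite mulr_ge0 ?visitation_ge0// kernel_ge0.
Qed.

Variables (u : S -> R) (a0 : A).
Hypothesis ud : is_distr u.

Lemma visitation_softmax_continuous (theta : Theta) s :
  {for theta, continuous (fun t : Theta => visitation M (softmax t) u s)}.
Proof.
have FF : Filter (nbhs theta) := nbhs_filter theta.
pose C := gamma M / (1 - gamma M) ^+ 2.
pose D (t : Theta) : R := \sum_s \sum_a `|softmax t s a - softmax theta s a|.
have D0 : D theta = 0.
  rewrite /D big1// => s' _; rewrite big1// => a _.
  by rewrite subrr normr0.
have cD : D t @[t --> theta] --> D theta.
  apply: (@cvg_finsum _ _ _ FF) => s'; apply: (@cvg_finsum _ _ _ FF) => a.
  apply: cvg_norm.
  apply: cvgB; last exact: cvg_cst.
  exact: (differentiable_continuous (diff_softmax theta s' a).1).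
have c0 : C * D t @[t --> theta] --> (0 : R).
  rewrite -(mulr0 C) -D0.
  exact: (cvgM (cvg_cst C) cD).
apply/cvgrPdist_le => e e0.
have /cvgrPdist_le/(_ e e0) H := c0.
near=> t.
apply: (@le_trans _ _ (C * D t)).
  rewrite distrC; apply: le_trans (visitation_lipschitz (softmax_policy theta a0)
    (softmax_policy t a0) ud (visitationP M (softmax_policy theta a0) ud)
    (visitationP M (softmax_policy t a0) ud)
    (visitation_ge0 M (softmax_policy t a0) ud)).
  by rewrite (bigD1 s)//= lerDl sumr_ge0.
have : `|0 - C * D t| <= e.
  by near: t; exact: H.
by rewrite sub0r normrN; apply: le_trans; exact: ler_norm.
Unshelve. all: by end_near. Qed.

Variables (theta : Theta) (v : S -> R).
Let pi := softmax theta.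
Hypothesis vb : is_bellman M pi (reg_reward pi) v.

Let W (t : Theta) := fine (value X f lambda pref (softmax t) u).

(** One-step improvement over [v] of the policy [softmax t] at [s]; it vanishes at
    [theta] by the Bellman equation. *)
Let H s (t : Theta) : R :=
  \sum_a (softmax t s a * action_value v s a -
          lambda * (pref s a * f (softmax t s a / pref s a))) - v s.

Let WE t : W t = \sum_s u s * v s + \sum_s visitation M (softmax t) u s * H s t.
Proof.
have pip := softmax_policy t a0; have pi0 := softmax_gt0 t.
rewrite /W (value_finite pip ud (generator0_fin pi0))/=.
apply/eqP; rewrite addrC -subr_eq.
rewrite (performance_difference _ v (visitationP M pip ud)).
apply/eqP; apply: eq_bigr => s _; rewrite reg_rewardE//.
by rewrite (fdivr_gt0 f (pref0 s) (pi0 s)) /H mulr_sumr -sumrB.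
Qed.

Let H0 s : H s theta = 0.
Proof.
have pip := softmax_policy theta a0; have pi0 := softmax_gt0 theta.
rewrite /H; apply/eqP; rewrite subr_eq0; apply/eqP.
by rewrite {1}(vb s) reg_rewardE// (fdivr_gt0 f (pref0 s) (pi0 s)) mulr_sumr -sumrB.
Qed.

Let dH s : differentiable (H s) theta /\
  forall w : Theta, 'd (H s) theta w = \sum_a local_gradient pi v s a *
    'd (fun t : Theta => softmax t s a) theta w.
Proof.
have pi0 := softmax_gt0 theta.
pose psi a (x : R) := x * action_value v s a - lambda * (pref s a * f (x / pref s a)).
have dpsi a : is_derive (softmax theta s a) 1 (psi a) (local_gradient pi v s a).
  have y0 : 0 < softmax theta s a / pref s a by rewrite divr_gt0.
  have dl : is_derive (softmax theta s a) 1 (fun x : R => x / pref s a) (pref s a)^-1.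
    rewrite (_ : (fun _ => _) = (pref s a)^-1 \*: (@id R)); last first.
      by apply/funext => x /=; rewrite mulrC.
    apply: (is_derive_eq (is_deriveZ (pref s a)^-1 (is_derive_id (softmax theta s a) 1))).
    by rewrite -[_ *: _]/((pref s a)^-1 * 1) mulr1.
  have df := @is_derive1_comp R f (fun x : R => x / pref s a) _ _ _
    (generator_is_derive gf y0) dl.
  have dq := is_deriveZ lambda (is_deriveZ (pref s a) df).
  have di := is_deriveZ (action_value v s a) (is_derive_id (softmax theta s a) 1).
  have dB := is_deriveB di dq.
  rewrite (_ : psi a = action_value v s a \*: (@id R) -
     lambda \*: (pref s a \*: (f \o (fun x : R => x / pref s a)))); last first.
    by apply/funext => x; rewrite /psi mulrC.
  apply: (is_derive_eq dB); rewrite /GRing.scale/= /local_gradient /pi.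
  by field; rewrite gt_eqF.
have dout a := diff_outer (diff_softmax theta s a).1 (@ex_derive _ _ _ _ _ _ _ (dpsi a)).
have HE : H s = (fun t : Theta => \sum_a psi a (softmax t s a)) - cst (v s).
  by apply/funext => t.
have [dS dSE] := differentiable_finsum (index_enum A) (fun a => (dout a).1).
rewrite HE; split; first exact: differentiableB.
move=> w; rewrite diffB//= diff_cst subr0 dSE.
apply: eq_bigr => a _; rewrite (dout a).2; congr (_ * _).
by rewrite derive1E (@derive_val _ _ _ _ _ _ _ (dpsi a)).
Qed.

Lemma policy_gradient :
  differentiable W theta /\ forall s a,
  'D_(delta_mx (enum_rank s) (enum_rank a)) W theta =
  visitation M pi u s * (pi s a * local_advantage pi v s a).
Proof.
have dmu s := diff_mul_zero (visitation_softmax_continuous (s := s))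
                (dH s).1 (H0 s).
have [dS dSE] := differentiable_finsum (index_enum S) (fun s => (dmu s).1).
have WE' : W = cst (\sum_s u s * v s) +
    (fun t => \sum_s visitation M (softmax t) u s * H s t).
  by apply/funext => t; rewrite WE.
have dW : differentiable W theta by rewrite WE'; exact: differentiableD.
split => // s a; rewrite deriveE//; set w := delta_mx _ _.
have -> : 'd W theta w =
    \sum_s' 'd (fun t => visitation M (softmax t) u s' * H s' t) theta w.
  by rewrite WE' diffD//= diff_cst add0r dSE.
rewrite (bigD1 s)//= big1 ?addr0; last first.
  move=> s' s's; rewrite (dmu s').2 (dH s').2 big1 ?mulr0// => b _.
  rewrite (diff_softmax theta s' b).2 /w mxE (inj_eq enum_rank_inj) (negbTE s's)/=.
  rewrite big1 ?subrr ?mulr0// => c _.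
  by rewrite mxE (inj_eq enum_rank_inj) (negbTE s's)/= mulr0.
rewrite (dmu s).2 (dH s).2; congr (_ * _).
have wE b : w (enum_rank s) (enum_rank b) = (b == a)%:R.
  by rewrite mxE eqxx (inj_eq enum_rank_inj).
have sw : \sum_b pi s b * w (enum_rank s) (enum_rank b) = pi s a.
  rewrite (bigD1 a)//= wE eqxx mulr1 big1 ?addr0// => b ba.
  by rewrite wE (negbTE ba) mulr0.
transitivity (\sum_b (local_gradient pi v s b * pi s b * (b == a)%:R
    - pi s a * (pi s b * local_gradient pi v s b))).
  apply: eq_bigr => b _.
  by rewrite (diff_softmax theta s b).2 -/pi wE sw; ring.
rewrite sumrB -mulr_sumr (bigD1 a)//= eqxx mulr1 big1 ?addr0; last first.
  by move=> b ba; rewrite (negbTE ba) mulr0.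
by rewrite /local_advantage; ring.
Qed.

End policy_gradient.

Lemma sum_enum_rank (R : nmodType) (T : finType) (F : 'I_#|T| -> R) :
  \sum_(i < #|T|) F i = \sum_x F (enum_rank x).
Proof. by apply: reindex; apply: onW_bij; exact: enum_rank_bij. Qed.

(** * The Lojasiewicz inequality *)

(** The reference policy has a finite value from every state, so an optimal
    policy has a finite divergence at every state. *)
Lemma optimal_fdiv_fin (R : realType) (S A : finType) (M : mdp R S A)
    (X : mdp_process M) (f : R -> R) (lambda : R) (pref pistar : S -> A -> R) :
  is_policy pref -> (forall s a, 0 < pref s a) -> 0 < lambda ->
  is_generator f -> is_optimal X f lambda pref pistar ->
  forall s a, generator0 f (pistar s a / pref s a) \is a fin_num.
Proof.
move=> prefp pref0 l0 gf [psp opt] s.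
have [//|foo] := fdiv_cases gf (pref0 s) (psp s).1.
have := opt _ prefp s.
rewrite (value_Ny X psp (point_mass_distr R s) l0 erefl foo).
rewrite (value_finite X lambda prefp (point_mass_distr R s)
  (generator0_fin f pref0 pref0)).
by rewrite leNgt ltNyr.
Qed.

Lemma lojasiewicz (R : realType) (S A : finType) (pref : S -> A -> R)
    (M : mdp R S A) (X : mdp_process M) (lambda : R) (f : R -> R)
    (u : S -> R) (c_u : R) (pistar : S -> A -> R)
    (theta : 'M[R]_(#|S|, #|A|)) (rho : S -> R) :
  is_policy pref -> (forall s a, 0 < pref s a) ->
  0 < lambda -> is_generator f ->
  is_distr u -> 0 < c_u -> (forall s, c_u <= u s) ->
  is_optimal X f lambda pref pistar -> is_distr rho ->
  let V := value X f lambda pref in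
  let Vu := fun theta : 'M[R]_(#|S|, #|A|) => fine (V (softmax theta) u) in
  [/\ V (softmax theta) u \is a fin_num,
      differentiable Vu theta &
      ((2 * lambda * c_u * minval (curvature f pref) *
         minval (fun sa : S * A => softmax theta sa.1 sa.2) ^+ 2 *
         (maxval (fun s => occupancy X pistar rho s /
                           occupancy X (softmax theta) u s))^-1)%:E *
       (V pistar rho - V (softmax theta) rho) <=
       (norm2 (gradient Vu theta) ^+ 2)%:E)%E].
Proof.
move=> prefp pref0 l0 gf ud cu0 cu optp rhod V Vu.
have [s0 _] := distr_inhabited ud.
have [a0 _] := distr_inhabited (prefp s0).
have psp := optp.1.
pose pi := softmax theta.
have pip : is_policy pi := softmax_policy theta a0.
have pi0 : forall s a, 0 < pi s a := softmax_gt0 theta.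
have pfin := generator0_fin f pref0 pi0.
have sfin := optimal_fdiv_fin prefp pref0 l0 gf optp.
have [v vb] := bellman_exists (reg_reward M f lambda pref pi)
  (fun s => visitationP M pip (point_mass_distr R s)).
have [dVu gVu] := policy_gradient X gf pref0 a0 ud vb.
split => //; first by rewrite /V (value_finite X lambda pip ud pfin).
pose mu := visitation M pi u.
pose mustar := visitation M pistar rho.
pose adv := local_advantage M f lambda pref pi v.
pose L s := reg_reward M f lambda pref pistar s
  + gamma M * (\sum_s' kernel M pistar s s' * v s') - v s.
have -> : (V pistar rho - V pi rho)%E = (\sum_s mustar s * L s)%:E.
  rewrite /V (value_finite X lambda psp rhod sfin).
  rewrite (value_finite X lambda pip rhod pfin) -EFinB.
  rewrite (visitation_bellman vb (visitationP M pip rhod)).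
  by rewrite (performance_difference _ v (visitationP M psp rhod)).
have -> : norm2 (gradient Vu theta) ^+ 2 =
    \sum_s \sum_a (mu s * (pi s a * adv s a)) ^+ 2.
  rewrite /norm2 sqr_sqrtr; last first.
    by apply: sumr_ge0 => i _; apply: sumr_ge0 => j _; exact: sqr_ge0.
  rewrite sum_enum_rank; apply: eq_bigr => s _.
  rewrite sum_enum_rank; apply: eq_bigr => a _.
  by rewrite mxE gVu.
rewrite -EFinM lee_fin.
have f2 := @generator_derive2_ge0 _ f gf.
have [cm_le [s1 cmE]] := minvalP (curvature f pref) s0.
have cm0 : 0 <= minval (curvature f pref) by rewrite cmE; exact: curvature_ge0.
have [pmin_le [[s2 a2] pminE]] := minvalP (fun sa : S * A => pi sa.1 sa.2) (s0, a0).
have [K_ge _] := maxvalP (fun s => occupancy X pistar rho s / occupancy X pi u s) s0.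
(* If the curvature coefficient vanishes, so does the left-hand side. *)
move: cm0; rewrite le_eqVlt => /predU1P[<-|cm0].
  rewrite mulr0 !mul0r; apply: sumr_ge0 => s _; apply: sumr_ge0 => a _.
  exact: sqr_ge0.
have mu_cu s : c_u <= mu s by exact: le_trans (cu s) (visitation_ge M s pip ud).
have mu0 s : 0 < mu s by exact: lt_le_trans (mu_cu s).
have g1 : 1 - gamma M != 0 by rewrite subr_eq0 gt_eqF// gamma_lt1.
set K := maxval _ in K_ge *.
have muK s : mustar s <= K * mu s.
  rewrite -ler_pdivrMr//; apply: le_trans (K_ge s).
  rewrite (occupancyE X psp rhod) (occupancyE X pip ud).
  by rewrite -mulf_div divff// mul1r.
(* The visitations of [pistar] have a positive sum, hence K is positive. *)
have K0 : 0 < K.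
  rewrite ltNge; apply/negP => K0.
  have : \sum_s mustar s <= 0.
    by apply: sumr_le0 => s _; apply: (le_trans (muK s)); rewrite mulr_le0_ge0// ltW.
  rewrite (sum_visitation psp rhod (visitationP M psp rhod)).
  by rewrite leNgt invr_gt0 subr_gt0 gamma_lt1.
apply: lojasiewicz_algebra => //.
- by rewrite pminE ltW.
- by move=> s; rewrite muK visitation_ge0.
- by move=> s a; exact: (pmin_le (s, a)).
move=> s.
have -> : L s =
    (\sum_a pistar s a * action_value M v s a - lambda * fdivr f (pistar s) (pref s))
    - (\sum_a pi s a * action_value M v s a - lambda * fdivr f (pi s) (pref s)).
  by rewrite /L reg_rewardE// {1}(vb s) reg_rewardE.
apply: regularized_gap => //.
by move=> r a rd ra; apply: le_trans (cm_le s) _; exact: curvature_le.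
Qed.

Theorem lemma3p13 (R : realType) (S A : finType) (pref : S -> A -> R)
    (pref_policy : is_policy pref) (pref_gt0 : forall s a, 0 < pref s a) :
  (forall (M : mdp R S A) (X : mdp_process M) (lambda : R) (f : R -> R)
      (u : S -> R) (c_u : R) (pistar : S -> A -> R),
    0 < lambda ->
    is_generator f ->
    is_distr u -> 0 < c_u -> (forall s, c_u <= u s) ->
    is_optimal X f lambda pref pistar ->
    let V := value X f lambda pref in
    let Vu := fun theta : 'M[R]_(#|S|, #|A|) => fine (V (softmax theta) u) in
    let c_m := minval (curvature f pref) in
    forall (theta : 'M[R]_(#|S|, #|A|)) (rho : S -> R), is_distr rho ->
      [/\ V (softmax theta) u \is a fin_num,
          differentiable Vu theta &
          ((2 * lambda * c_u * c_m *
             minval (fun sa : S * A => softmax theta sa.1 sa.2) ^+ 2 *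
             (maxval (fun s => occupancy X pistar rho s /
                               occupancy X (softmax theta) u s))^-1)%:E *
           (V pistar rho - V (softmax theta) rho) <=
           (norm2 (gradient Vu theta) ^+ 2)%:E)%E])
  /\
  (forall s : S,
    [/\ forall alpha : R, 0 < alpha < 1 ->
          curvature (alpha_gen alpha) pref s = minval (pref s) `^ alpha,
        curvature (@reverse_KL_gen R) pref s = 1,
        curvature (@forward_KL_gen R) pref s = minval (pref s),
        curvature (@JS_gen R) pref s =
          minval (fun a => pref s a / (1 + pref s a)) &
        curvature (@chi2_gen R) pref s = minval (fun a => 2 / pref s a)]).
Proof.
split=> [M X lambda f u c_u pistar l0 gf ud cu0 cu opt V Vu c_m theta rho rhod|s].
  exact: lojasiewicz.
exact: curvature_examples.
Qed.
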